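(* Let $\{a_i\}_{i\ge1}$ and $\{b_i\}_{i\ge1}$ be strictly positive sequences with $\sum_{i\ge1}a_i+\sum_{i\ge1}b_i=1$, let $b_0=0$, and let $\varpi$ be the distribution on $\mathbb{N}\times\mathbb{N}$ ($\mathbb{N}=\{1,2,\dots\}$) with density (with respect to counting measure) $\pi(x,y)=a_x$ if $x=y$, $\pi(x,y)=b_y$ if $x=y+1$, and $\pi(x,y)=0$ otherwise. Let $p\in(0,1)$ and let $\Phi_X$, $\Phi_{DGS}$, $\Phi_{RGS}$ be the associated marginal chain, deterministic scan Gibbs sampler and random scan Gibbs sampler with selection probability $p$. Define $$p_x=\frac{a_xb_x}{(a_x+b_{x-1})(a_x+b_x)}\ (x\ge1),\qquad q_x=\frac{a_{x-1}b_{x-1}}{(a_x+b_{x-1})(a_{x-1}+b_{x-1})}\ (x\ge2).$$ Assume that both $A:=\lim_{i\to\infty}\frac{a_i}{a_{i-1}}$ and $\lim_{i\to\infty}\frac{a_i}{b_i}$ exist. Then all the limits below are well defined and the following statements are equivalent: (a) $\lim_{i\to\infty}\frac{a_i}{b_{i-1}}<\infty$, $\ \lim_{i\to\infty}\frac{b_i}{a_i}<\infty$, and $A<1$. (b) $r=\lim_{i\to\infty}\frac{p_i}{q_i}<1$ and $q=\lim_{i\to\infty}q_i>0$. (c) $\Phi_X$ is geometrically ergodic. (d) $\Phi_{DGS}$ is geometrically ergodic. (e) $\Phi_{RGS}$ is geometrically ergodic.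
   Context: Marginals: $\pi_X(x)=a_x+b_{x-1}$ and $\pi_Y(y)=a_y+b_y$. Conditionals: $\pi_{X|Y}(x|y)=\pi(x,y)/\pi_Y(y)$, which gives mass $\frac{a_y}{a_y+b_y}$ to $x=y$ and $\frac{b_y}{a_y+b_y}$ to $x=y+1$; $\pi_{Y|X}(y|x)=\pi(x,y)/\pi_X(x)$, which gives mass $\frac{a_x}{a_x+b_{x-1}}$ to $y=x$ and $\frac{b_{x-1}}{a_x+b_{x-1}}$ to $y=x-1$. Chains. $\Phi_{DGS}$ is the Markov chain with transition probabilities $k_{DGS}(x',y'|x,y)=\pi_{X|Y}(x'|y)\pi_{Y|X}(y'|x')$ and invariant distribution $\varpi$. $\Phi_X$ is the Markov chain on $\mathbb{N}$ with transition probabilities $k_X(x'|x)=\sum_{y\ge1}\pi_{X|Y}(x'|y)\pi_{Y|X}(y|x)$ and invariant distribution $\varpi_X$ (the $X$-marginal of $\varpi$); it is the birth–death chain with up-probability $p_x$ for $x\ge1$ and down-probability $q_x$ for $x\ge2$, otherwise staying put. $\Phi_{RGS}$ is the Markov chain that from $(x,y)$, with probability $p$ moves to $(x',y)$ with $x'\sim\pi_{X|Y}(\cdot|y)$ and with probability $1-p$ moves to $(x,y')$ with $y'\sim\pi_{Y|X}(\cdot|x)$; its invariant distribution is $\varpi$. A chain on $\mathsf{Z}$ with kernel $P$, $n$-step kernel $P^n$ and invariant probability $w$ is geometrically ergodic if there exist a real-valued function $M$ on $\mathsf{Z}$ and $0<t<1$ such that $\|P^n(z,\cdot)-w(\cdot)\|_{TV}\le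 M(z)t^n$ for all $z\in\mathsf{Z}$ and all $n$, where $\|\cdot\|_{TV}$ is the total variation norm. *)

(* Defs.v *)
From HB Require Import structures.
From mathcomp Require Import all_boot all_order all_algebra.
From mathcomp Require Import all_classical all_reals all_analysis.

Set Implicit Arguments.
Unset Strict Implicit.
Unset Printing Implicit Defensive.
Import Order.TTheory GRing.Theory Num.Theory.
Import numFieldNormedType.Exports.
Local Open Scope classical_set_scope.
Local Open Scope ring_scope.
Local Open Scope ereal_scope.

(* Markov chains on a discrete state space Z, given as a subset of a
   choiceType T.  A kernel P is its mass function: P z z' is the probability of
   moving from z to z'; only its values on Z matter. *)
Section chains.
Context {R : realType} {T : choiceType}.
Implicit Types (Z A : set T) (P : T -> T -> \bar R) (w : T -> \bar R).

Fixpoint nstep Z P (n : nat) (z z' : T) : \bar R :=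
  if n is m.+1 then \esum_(u in Z) (P z u * nstep Z P m u z')
  else ((z == z')%:R)%:E.

Definition mass (f : T -> \bar R) A : \bar R := \esum_(z in A) f z.

(* Total variation distance, normalised as the supremum over events; the other
   usual normalisation (total mass of |f - g|) is twice this, a factor which is
   absorbed by the function M of geometrically_ergodic. *)
Definition tv_dist Z (f g : T -> \bar R) : \bar R :=
  ereal_sup [set `|mass f A - mass g A| | A in [set A | A `<=` Z]].

Definition geometrically_ergodic Z P w : Prop :=
  exists (M : T -> R) (t : R), (0 < t < 1)%R /\
    forall z n, Z z -> tv_dist Z (nstep Z P n z) w <= (M z * t ^+ n)%:E.

End chains.

Definition posnat : set nat := [set n | (0 < n)%N].

Section gibbs.
Context {R : realType}.
Variables a b : nat -> R.
Implicit Types x y : nat.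

(* Throughout, a, b and the functions below matter only on positive indices,
   except for b 0 = 0. *)
Definition pi_joint x y : R :=
  if x == y then a x else if x == y.+1 then b y else 0%R.

(* Closed forms of the sums of pi_joint: see pi_X_sum and pi_Y_sum. *)
Definition pi_X x : R := (a x + b x.-1)%R.
Definition pi_Y y : R := (a y + b y)%R.

Definition pi_XgY x y : R := (pi_joint x y / pi_Y y)%R.
Definition pi_YgX y x : R := (pi_joint x y / pi_X x)%R.

Definition k_X x x' : \bar R :=
  \esum_(y in posnat) (pi_XgY x' y * pi_YgX y x)%:E.

Definition k_DGS (z z' : nat * nat) : \bar R :=
  (pi_XgY z'.1 z.2 * pi_YgX z'.2 z'.1)%:E.

Definition k_RGS (p : R) (z z' : nat * nat) : \bar R :=
  (p * (pi_XgY z'.1 z.2 * (z'.2 == z.2)%:R)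
   + (1 - p) * (pi_YgX z'.2 z.1 * (z'.1 == z.1)%:R))%:E.

Definition varpi (z : nat * nat) : \bar R := (pi_joint z.1 z.2)%:E.
Definition varpi_X x : \bar R := (pi_X x)%:E.

(* The birth-death rates p_x (x >= 1) and q_x (x >= 2) of k_X. *)
Definition p_up x : R := (a x * b x / ((a x + b x.-1) * (a x + b x)))%R.
Definition q_down x : R :=
  (a x.-1 * b x.-1 / ((a x + b x.-1) * (a x.-1 + b x.-1)))%R.

Definition Phi_X_ge : Prop := geometrically_ergodic posnat k_X varpi_X.
Definition Phi_DGS_ge : Prop :=
  geometrically_ergodic (posnat `*` posnat) k_DGS varpi.
Definition Phi_RGS_ge (p : R) : Prop :=
  geometrically_ergodic (posnat `*` posnat) (k_RGS p) varpi.

Hypothesis a_gt0 : forall i, (0 < i)%N -> (0 < a i)%R.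
Hypothesis b_gt0 : forall i, (0 < i)%N -> (0 < b i)%R.
Hypothesis b0 : b 0%N = 0%R.

Let b_ge0 i : (0 <= b i)%R.
Proof. by case: i => [|i]; rewrite ?b0// ltW// b_gt0. Qed.

Lemma pi_joint_ge0 x y : (0 < x)%N -> (0 <= pi_joint x y)%R.
Proof.
by move=> x0; rewrite /pi_joint; case: ifP => _; [exact/ltW/a_gt0|case: ifP].
Qed.

Let esum2 (f : nat -> \bar R) i j : posnat i -> i != j ->
  (forall k, posnat k -> 0 <= f k) -> (0 <= f j) ->
  (~ posnat j -> f j = 0) ->
  (forall k, k != i -> k != j -> f k = 0) ->
  \esum_(k in posnat) f k = f i + f j.
Proof.
move=> Pi ij f0 fj0 fj fk; rewrite (esumID [set i])//; congr (_ + _).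
  by rewrite (_ : _ `&` _ = [set i]) ?esum_set1 ?f0//; apply: setIidr => _ ->.
rewrite (esumID [set j]) => [|k []/f0//].
rewrite [X in _ + X]esum1 ?adde0; last first.
  by move=> k [[_ /eqP ki] /eqP kj]; exact: fk.
have [Pj|Pj] := pselect (posnat j).
  rewrite (_ : _ `&` _ = [set j]) ?esum_set1//; apply: setIidr => _ ->.
  by split=> //=; apply/eqP; rewrite eq_sym.
by rewrite fj// esum1// => k [_ ->]; exact: fj.
Qed.

Lemma pi_X_sum x : (0 < x)%N ->
  \esum_(y in posnat) (pi_joint x y)%:E = (pi_X x)%:E.
Proof.
move=> x0; have xx : (x == x.-1) = false by case: x x0 => // n _; rewrite eqn_leq ltnn.
have xS : (x == x.-1.+1) by rewrite prednK.
rewrite (@esum2 _ x x.-1) ?xx// /pi_X /pi_joint ?eqxx ?xx ?xS ?lee_fin//.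
- by move=> k _; rewrite lee_fin; exact: pi_joint_ge0.
- by move=> /negP; rewrite -eqn0Ngt => /eqP ->; rewrite b0.
- move=> k kx kx1; rewrite eq_sym (negbTE kx); case: eqP => // xk.
  by move: kx1; rewrite xk eqxx.
Qed.

Lemma pi_Y_sum y : (0 < y)%N ->
  \esum_(x in posnat) (pi_joint x y)%:E = (pi_Y y)%:E.
Proof.
move=> y0; have yy : (y.+1 == y) = false by rewrite eqn_leq ltnn.
rewrite (@esum2 _ y y.+1) /pi_Y /pi_joint ?eqxx ?yy ?lee_fin//.
- by rewrite eq_sym yy.
- by move=> k k0; rewrite lee_fin; exact: pi_joint_ge0.
- by move=> [].
- by move=> k ky ky1; rewrite (negbTE ky) (negbTE ky1).
Qed.

End gibbs.

(* Main.v *)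
(* On the path (1,1), (2,1), (2,2), (3,2), ... carrying the masses a_1, b_1,
   a_2, b_2, ..., the random scan sampler is a reversible birth-death chain, and
   so is the marginal chain on {1, 2, ...}; the deterministic scan sampler is
   the marginal chain with one extra half step at each end.  With
   L = lim a_i / b_i, both (a) and (b) say that L > 0 and A < 1.

   If L > 0 and A < 1, the stationary tail beyond an edge is at most a constant
   times the conductance of that edge.  A discrete Hardy inequality then bounds
   the variance of f by its Dirichlet form, and, the holding probabilities of
   two neighbours having a sum bounded away from 0, each step contracts the
   variance by a fixed factor.

   Conversely, a chain started at a fixed state moves by at most one edge per
   step, so geometric ergodicity at rate t makes the stationary masses O(t^n):
   hence A < 1.  Moreover, by Cauchy-Schwarz, the variance of P^n 1_i is
   log-convex in n; as it is O(t^(2n)), already its first ratio is at most t^2,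
   which gives P(i,i)^2 <= t^2 + w_i, where w_i is the mass of i.  If L = 0,
   P(i,i) tends to 1 along the states of mass b_i (for the marginal chain, along
   all states), a contradiction. *)
Require Import Defs.
From HB Require Import structures.
From mathcomp Require Import all_boot all_order all_algebra.
From mathcomp Require Import all_classical all_reals all_analysis.
From mathcomp Require Import ring lra zify.
Import Order.TTheory GRing.Theory Num.Theory.
Import numFieldNormedType.Exports.
Local Open Scope classical_set_scope.
Local Open Scope ring_scope.

Set Implicit Arguments.
Unset Strict Implicit.
Unset Printing Implicit Defensive.

Lemma geometric_lt {R : realType} (z M x : R) : 0 <= z < 1 -> 0 < x ->
  exists N, forall n, (N <= n)%N -> M * z ^+ n < x.
Proof.
move=> /andP[z0 z1] x0.
have : (fun n => M * z ^+ n) @ \oo --> (0 : R).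
  rewrite -[X in _ --> X](mulr0 M); apply: cvgMr.
  by apply: cvg_expr; rewrite ger0_norm.
by move=> /cvgr_lt /(_ _ x0) [N _ NP]; exists N => n /NP.
Qed.

(** * Reversible birth-death chains *)

Section birth_death.
Context {R : realType} (w c : nat -> R).
Implicit Types (f g : nat -> R) (N k : nat).

(* [w j] is the stationary mass of [j] and [c j] the conductance of the edge
   between [j.-1] and [j]; the junk edge at [j = 0] is switched off by
   [c 0 = 0]. *)
Definition bd_op f j : R :=
  f j + (c j.+1 * (f j.+1 - f j) + c j * (f j.-1 - f j)) / w j.

Definition exit_prob j : R := (c j + c j.+1) / w j.

Definition ip N f g : R := \sum_(j < N) w j * (f j * g j).
Definition mean N f : R := \sum_(j < N) w j * f j.
Definition cov N f g : R := ip N f g - mean N f * mean N g.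
Definition dirichlet N f g : R :=
  \sum_(j < N) c j.+1 * ((f j.+1 - f j) * (g j.+1 - g j)).

Definition supported k f := forall j, (k <= j)%N -> f j = 0.

Hypothesis w_gt0 : forall j, 0 < w j.
Hypothesis c0 : c 0%N = 0.
Hypothesis c_ge0 : forall j, 0 <= c j.
Hypothesis exit_le1 : forall j, c j + c j.+1 <= w j.
Hypothesis mass_le1 : forall N, \sum_(j < N) w j <= 1.

Lemma supportedW k l f : (k <= l)%N -> supported k f -> supported l f.
Proof. by move=> kl kf j /(leq_trans kl); exact: kf. Qed.

Lemma bd_op_supported k f : supported k f -> supported k.+1 (bd_op f).
Proof.
move=> kf [//|j] kj; rewrite /bd_op /= !kf; [|lia..].
by rewrite subrr !mulr0 !add0r mul0r.
Qed.

Lemma iter_bd_op_supported k f n :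
  supported k f -> supported (k + n) (iter n bd_op f).
Proof.
by move=> kf; elim: n => [|n IH]; rewrite ?addn0// addnS; exact: bd_op_supported.
Qed.

Lemma ip_widen k N f g : supported k f -> (k <= N)%N -> ip N f g = ip k f g.
Proof.
move=> kf; elim: N => [|N IH]; first by rewrite leqn0 => /eqP ->.
rewrite leq_eqVlt => /predU1P[->//|kN].
by rewrite /ip big_ord_recr/= kf// mul0r mulr0 addr0; exact: IH.
Qed.

Lemma mean_widen k N f : supported k f -> (k <= N)%N -> mean N f = mean k f.
Proof.
move=> kf kN; have := ip_widen (fun=> 1) kf kN.
by rewrite /ip /mean; under eq_bigr do rewrite mulr1;
  under [in RHS]eq_bigr do rewrite mulr1.
Qed.

Lemma ip_sym N f g : ip N f g = ip N g f.
Proof. by apply: eq_bigr => j _; rewrite [f j * _]mulrC. Qed.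

(** Expanding the square around the mean [m] leaves the defect [m ^+ 2 * (1 - W)], where the
    truncated mass [W] is at most 1. *)
Lemma sum_sqr_dev_le_cov N f :
  \sum_(j < N) w j * (f j - mean N f) ^+ 2 <= cov N f f.
Proof.
have W1 := mass_le1 N; rewrite /cov; move Em : (mean N f) => m.
have -> : \sum_(j < N) w j * (f j - m) ^+ 2 =
    ip N f f - 2 * m * mean N f + m ^+ 2 * \sum_(j < N) w j.
  rewrite /mean !mulr_sumr /ip -sumrB -big_split/=.
  by apply: eq_bigr => j _; ring.
by rewrite Em; have := sqr_ge0 m; nra.
Qed.

Lemma cov_ge0 N f : 0 <= cov N f f.
Proof.
apply: le_trans (sum_sqr_dev_le_cov N f).
by apply: sumr_ge0 => j _; rewrite mulr_ge0 ?sqr_ge0// ltW.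
Qed.

Lemma covDZ N f g (s t : R) :
  cov N (fun j => s * f j + t * g j) (fun j => s * f j + t * g j) =
  s ^+ 2 * cov N f f + 2 * s * t * cov N f g + t ^+ 2 * cov N g g.
Proof.
have -> : cov N (fun j => s * f j + t * g j) (fun j => s * f j + t * g j) =
    s ^+ 2 * ip N f f + 2 * s * t * ip N f g + t ^+ 2 * ip N g g
    - (s * mean N f + t * mean N g) ^+ 2.
  rewrite /cov expr2; congr (_ - _ * _).
  - by rewrite /ip !mulr_sumr -!big_split/=; apply: eq_bigr => j _; ring.
  - by rewrite /mean !mulr_sumr -!big_split/=; apply: eq_bigr => j _; ring.
  - by rewrite /mean !mulr_sumr -!big_split/=; apply: eq_bigr => j _; ring.
by rewrite /cov; ring.
Qed.

Lemma cov_cauchy_schwarz N f g : cov N f g ^+ 2 <= cov N f f * cov N g g.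
Proof.
have H s t : 0 <= s ^+ 2 * cov N f f + 2 * s * t * cov N f g + t ^+ 2 * cov N g g.
  by rewrite -covDZ cov_ge0.
have [ff gg] := (cov_ge0 N f, cov_ge0 N g).
set x := cov N f f in H ff *; set y := cov N g g in H gg *.
set z := cov N f g in H *.
move: ff gg; rewrite le_eqVlt => /predU1P[x0 y0|x0 _].
  (* When the first variance is 0 the form is linear in [s]; these coefficients give
     [- (z ^+ 2 * (y + 2))], which forces [z = 0]. *)
  have := H (- (y + 1)) z; rewrite -x0 mul0r.
  rewrite (_ : _ + _ = - (z ^+ 2 * (y + 2))); last by ring.
  by rewrite oppr_ge0 pmulr_lle0//; lra.
have := H (- z) x.
rewrite (_ : _ + _ = x * (x * y - z ^+ 2)); last by ring.
by rewrite pmulr_rge0// subr_ge0.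
Qed.

(** Summation by parts along the path. The last term is the flow through the edge between [N.-1] and
    [N], left unpaired by the truncation; [c 0 = 0] removes its counterpart at the other end. *)
Lemma ip_bd_op N f g :
  ip N g (bd_op f) = ip N g f - dirichlet N f g + g N * c N * (f N - f N.-1).
Proof.
rewrite /ip /dirichlet; elim: N => [|N IH]; first by rewrite !big_ord0 c0; ring.
rewrite !big_ord_recr/= {}IH /bd_op; have := w_gt0 N; move=> wN.
by field; rewrite gt_eqF.
Qed.

Lemma ip_bd_op_supported N f g : supported N g ->
  ip N g (bd_op f) = ip N g f - dirichlet N f g.
Proof. by move=> Ng; rewrite ip_bd_op Ng// !mul0r addr0. Qed.

Lemma bd_op_sym N f g : supported N f -> supported N g ->
  ip N g (bd_op f) = ip N (bd_op g) f.
Proof.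
move=> Nf Ng; rewrite [RHS]ip_sym !ip_bd_op_supported// [in RHS]ip_sym.
by congr (_ - _); apply: eq_bigr => j _; rewrite [X in _ * X]mulrC.
Qed.

(** Stationarity of [w]: summation by parts against the constant 1. The support ends early enough
    for the flow through the last edge to vanish. *)
Lemma mean_bd_op N f : supported N.-1 f -> mean N (bd_op f) = mean N f.
Proof.
move=> Nf; have := ip_bd_op N f (fun=> 1).
rewrite [f N]Nf ?leq_pred// [f N.-1]Nf// subrr mulr0 addr0.
rewrite [dirichlet _ _ _]big1 ?subr0 => [|j _]; last by rewrite subrr !mulr0.
by rewrite /ip /mean; under eq_bigr do rewrite mul1r;
  under [in RHS]eq_bigr do rewrite mul1r.
Qed.

Lemma mean_iter_bd_op N f n k :
  supported k f -> (k + n <= N)%N -> mean N (iter n bd_op f) = mean N f.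
Proof.
move=> kf; elim: n => //= n IH knN; rewrite mean_bd_op; first by apply: IH; lia.
apply: (supportedW _ (iter_bd_op_supported (n := n) kf)); lia.
Qed.

Lemma bd_op_ge0 f : (forall j, 0 <= f j) -> forall j, 0 <= bd_op f j.
Proof.
move=> f0 j; have wj := w_gt0 j.
have -> : bd_op f j =
    ((w j - (c j + c j.+1)) * f j + c j.+1 * f j.+1 + c j * f j.-1) / w j.
  by rewrite /bd_op; field; rewrite gt_eqF.
apply: divr_ge0; last exact: ltW.
by rewrite !addr_ge0// ?mulr_ge0// subr_ge0.
Qed.

(** Cauchy-Schwarz with weights [c j.+1] and [c j] on the two edges at [j]: up to the factor
    [1 / w j], the gap is [c j * c j.+1 * (u + v) ^+ 2] for the increments [u] and [v] across
    them. *)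
Lemma sqr_increment_le j f : w j * (bd_op f j - f j) ^+ 2 <=
  exit_prob j * (c j.+1 * (f j.+1 - f j) ^+ 2 + c j * (f j - f j.-1) ^+ 2).
Proof.
have wj := w_gt0 j; rewrite /bd_op addrC addKr /exit_prob.
set u := f j.+1 - f j; rewrite -(opprB (f j) (f j.-1)); set v := f j - f j.-1.
rewrite (_ : w j * _ = (c j.+1 * u - c j * v) ^+ 2 / w j); last first.
  by field; rewrite gt_eqF.
rewrite [leRHS]mulrAC ler_pM2r ?invr_gt0//.
rewrite -subr_ge0 (_ : _ - _ = c j * c j.+1 * (u + v) ^+ 2); last by ring.
by rewrite mulr_ge0 ?sqr_ge0// mulr_ge0.
Qed.

(** * One-step contraction of the second moment *)

Section contraction.
Variable h : R.
Hypothesis exit_le : forall j, exit_prob j + exit_prob j.+1 <= 2 - h.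

(** An inner edge is counted from both of its ends, hence with the sum of two neighbouring exit
    probabilities. The edge after [N] is seen from its left end only and stays as a remainder. *)
Lemma sum_sqr_increment_le N f :
  \sum_(j < N.+1) w j * (bd_op f j - f j) ^+ 2 <=
  (2 - h) * dirichlet N f f + exit_prob N * (c N.+1 * (f N.+1 - f N) ^+ 2).
Proof.
rewrite /dirichlet; elim: N => [|N IH].
  rewrite big_ord_recr !big_ord0/= mulr0 !add0r.
  by have := sqr_increment_le 0 f; rewrite c0 mul0r addr0.
rewrite big_ord_recr/=; apply: le_trans (lerD IH (sqr_increment_le _ _)) _.
rewrite big_ord_recr/= -expr2.
have := exit_le N; have : 0 <= c N.+1 * (f N.+1 - f N) ^+ 2.
  by rewrite mulr_ge0 ?sqr_ge0.
by set x := c N.+1 * _; set y := c N.+2 * _; set s := \sum_(_ < _) _; nra.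
Qed.

(** The squared norm of [bd_op f] is that of [f], minus twice the Dirichlet form, plus that of
    [bd_op f - f], which costs at most [2 - h] Dirichlet forms. The [h] that remains is the gain
    from holding; it rules out oscillations of period two. *)
Lemma bd_op_contract N f : supported N f ->
  ip N.+1 (bd_op f) (bd_op f) <= ip N.+1 f f - h * dirichlet N.+1 f f.
Proof.
move=> Nf; have := sum_sqr_increment_le N.+1 f.
rewrite [f N.+2]Nf ?[f N.+1]Nf; [|lia|lia].
rewrite subrr expr0n !mulr0 addr0 big_ord_recr/=.
have -> : \sum_(j < N.+1) w j * (bd_op f j - f j) ^+ 2 =
    ip N.+1 (bd_op f) (bd_op f) - 2 * ip N.+1 f (bd_op f) + ip N.+1 f f.
  rewrite /ip mulr_sumr -sumrB -big_split/=.
  by apply: eq_bigr => j _; ring.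
rewrite [ip _ f (bd_op f)]ip_bd_op_supported; last exact: (supportedW _ Nf).
have : 0 <= w N.+1 * (bd_op f N.+1 - f N.+1) ^+ 2.
  by rewrite mulr_ge0 ?sqr_ge0// ltW.
by set x := ip _ _ _; set y := ip _ _ _; set z := dirichlet _ _ _; lra.
Qed.

End contraction.

(* [V j] plays the role of the tail mass [\sum_(k >= j) w k]; only the
   properties assumed here matter. *)
Section poincare.
Variables (V : nat -> R) (C : R).
Hypothesis C_gt0 : 0 < C.
Hypothesis V_ge0 : forall j, 0 <= V j.
Hypothesis V_decr : forall j, w j <= V j - V j.+1.
Hypothesis V_le : forall j, V j.+1 <= C * c j.+1.
Hypothesis mass_cvg : forall e, 0 < e -> exists N, 1 - e <= \sum_(j < N) w j.

Lemma abel_sum N f : f 0%N = 0 ->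
  \sum_(j < N) (V j.+1 - V j.+2) * f j.+1 ^+ 2 =
  \sum_(j < N) V j.+1 * (f j.+1 ^+ 2 - f j ^+ 2) - V N.+1 * f N ^+ 2.
Proof.
move=> f0; elim: N => [|N IH]; first by rewrite !big_ord0 f0; ring.
by rewrite !big_ord_recr/= IH; ring.
Qed.

(* AM-GM: [2 C D S <= 4 C^2 D^2 + S^2 / 4] with [D = x - y] and [S = x + y],
   and [S^2 <= 2 x^2 + 2 y^2]. *)
Lemma sqr_diff_le v d (x y : R) : 0 <= v -> v <= C * d -> 0 <= d ->
  v * (x ^+ 2 - y ^+ 2) <=
  2 * C ^+ 2 * (d * (x - y) ^+ 2) + d * (x ^+ 2 + y ^+ 2) / 4.
Proof.
move=> v0 vC d0.
apply: (@le_trans _ _ (C * d * `|x ^+ 2 - y ^+ 2|)).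
  apply: le_trans (ler_norm _) _; rewrite normrM (ger0_norm v0).
  by rewrite ler_wpM2r.
rewrite -subr_ge0.
have H s : `|x ^+ 2 - y ^+ 2| = s * (x ^+ 2 - y ^+ 2) -> s ^+ 2 = 1 ->
    0 <= 2 * C ^+ 2 * (d * (x - y) ^+ 2) + d * (x ^+ 2 + y ^+ 2) / 4 -
    C * d * `|x ^+ 2 - y ^+ 2|.
  move=> -> s1; rewrite (_ : _ - _ = d / 8 *
      ((4 * C * (x - y) - s * (x + y)) ^+ 2 + (x - y) ^+ 2
        + (1 - s ^+ 2) * (x + y) ^+ 2)); last by field.
  rewrite s1 subrr mul0r addr0.
  by rewrite mulr_ge0 ?addr_ge0 ?sqr_ge0// divr_ge0.
have [xy|xy] := ler0P (x ^+ 2 - y ^+ 2).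
- by have := H (-1); rewrite ler0_norm// mulN1r sqrrN expr1n; apply.
- by have := H 1; rewrite gtr0_norm// mul1r expr1n; apply.
Qed.

(** Abel summation bounds the left side [X] by the increments of [f ^+ 2] weighted by the tails [V].
    By [sqr_diff_le] these are at most [2 * C ^+ 2 * E] plus a term which, as [c] is below [w] at
    both ends of an edge, is at most [X / 2] and is absorbed. *)
Lemma hardy N f : f 0%N = 0 ->
  \sum_(j < N) w j.+1 * f j.+1 ^+ 2 <=
  4 * C ^+ 2 * \sum_(j < N) c j.+1 * (f j.+1 - f j) ^+ 2.
Proof.
move=> f0; set X := \sum_(j < N) _; set E := \sum_(j < N) _.
have XV : X <= \sum_(j < N) V j.+1 * (f j.+1 ^+ 2 - f j ^+ 2).
  apply: (@le_trans _ _ (\sum_(j < N) (V j.+1 - V j.+2) * f j.+1 ^+ 2)).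
    by apply: ler_sum => j _; rewrite ler_wpM2r ?sqr_ge0.
  by rewrite abel_sum// gerBl mulr_ge0 ?sqr_ge0.
have XX : \sum_(j < N) w j * f j ^+ 2 <= X.
  have -> : X = \sum_(j < N.+1) w j * f j ^+ 2.
    by rewrite big_ord_recl/= f0 expr0n mulr0 add0r.
  rewrite big_ord_recr/= lerDl; apply: mulr_ge0; [exact: ltW|exact: sqr_ge0].
have cX : \sum_(j < N) c j.+1 * (f j.+1 ^+ 2 + f j ^+ 2) <= X + X.
  apply: le_trans (lerD (lexx X) XX); rewrite -big_split/=.
  apply: ler_sum => j _; rewrite mulrDr lerD// ler_wpM2r ?sqr_ge0//.
    by apply: le_trans (exit_le1 j.+1); rewrite lerDl.
  by apply: le_trans (exit_le1 j); rewrite lerDr.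
have : X <= 2 * C ^+ 2 * E + (X + X) / 4.
  apply: (le_trans XV).
  apply: (@le_trans _ _ (2 * C ^+ 2 * E +
      (\sum_(j < N) c j.+1 * (f j.+1 ^+ 2 + f j ^+ 2)) / 4)); last by lra.
  rewrite mulr_sumr mulr_suml -big_split/=; apply: ler_sum => j _.
  exact: sqr_diff_le.
by lra.
Qed.

Lemma dirichlet_widen k N f :
  supported k f -> (k <= N)%N -> dirichlet N f f = dirichlet k f f.
Proof.
move=> kf; elim: N => [|N IH]; first by rewrite leqn0 => /eqP ->.
rewrite leq_eqVlt => /predU1P[->//|kN].
rewrite /dirichlet big_ord_recr/= !kf; [|lia..].
by rewrite subrr !mulr0 addr0; exact: IH.
Qed.

(** The variance is at most the second moment around [f 0], and Hardy applies to [f - f 0]. That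
    function is not finitely supported, so the truncation is sent to infinity, where the mass tends
    to 1. *)
Lemma poincare k f : supported k f ->
  cov k f f <= 4 * C ^+ 2 * dirichlet k f f.
Proof.
move=> kf; set D := _ * dirichlet _ _ _.
have H N : (k <= N)%N -> ip k f f - 2 * f 0%N * mean k f +
    f 0%N ^+ 2 * \sum_(j < N.+1) w j <= D.
  move=> kN; rewrite -(ip_widen f kf (leqW kN)) -(mean_widen kf (leqW kN)).
  rewrite /D -(dirichlet_widen kf kN).
  rewrite (_ : _ + _ = \sum_(j < N.+1) w j * (f j - f 0%N) ^+ 2); last first.
    rewrite /ip /mean !mulr_sumr -sumrB -big_split/=.
    by apply: eq_bigr => j _; ring.
  rewrite big_ord_recl/= subrr expr0n mulr0 add0r.
  apply: le_trans (hardy N (f := fun j => f j - f 0%N) _) _; first exact: subrr.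
  rewrite le_eqVlt; apply/orP; left; apply/eqP; congr (_ * _).
  by apply: eq_bigr => j _; ring.
rewrite /cov.
suff : ip k f f - 2 * f 0%N * mean k f + f 0%N ^+ 2 <= D.
  by have := sqr_ge0 (mean k f - f 0%N); lra.
apply/ler_addgt0Pr => e e0.
(* The missing mass gets multiplied by [f 0 ^+ 2], so it is taken below [e / (f 0 ^+ 2 + 1)]; the
   [+ 1] covers [f 0 = 0]. *)
have f1 : 0 < f 0%N ^+ 2 + 1 by rewrite ltr_wpDl ?sqr_ge0.
have [N WN] := mass_cvg (divr_gt0 e0 f1).
have {}WN : 1 - e / (f 0%N ^+ 2 + 1) <= \sum_(j < (maxn k N).+1) w j.
  apply: le_trans WN _; rewrite (big_ord_widen _ _ (leqW (leq_maxr k N))).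
  rewrite big_mkcond/=; apply: ler_sum => j _.
  by case: ifP => // _; exact: ltW.
have := H _ (leq_maxl k N).
have : f 0%N ^+ 2 * (e / (f 0%N ^+ 2 + 1)) <= e.
  by rewrite mulrA ler_pdivrMr// mulrC ler_wpM2l ?lerDl// ltW.
have := sqr_ge0 (f 0%N); nra.
Qed.

Variables h r : R.
Hypothesis exit_le : forall j, exit_prob j + exit_prob j.+1 <= 2 - h.
Hypothesis h_ge0 : 0 <= h.
Hypothesis r_ge : 1 - h / (4 * C ^+ 2) <= r.
Hypothesis r_ge0 : 0 <= r.

(** The mean being invariant, the contraction passes from second moments to variances, and Poincaré
    turns the Dirichlet form lost into a share of the variance. A nonnegative [r] lets the bound be
    iterated with no discussion of the sign of [1 - h / (4 * C ^+ 2)]. *)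
Lemma cov_bd_op_le N f : supported N f ->
  cov N.+1 (bd_op f) (bd_op f) <= r * cov N.+1 f f.
Proof.
move=> Nf; have := bd_op_contract exit_le Nf.
have := poincare (supportedW (leqnSn _) Nf).
have := cov_ge0 N.+1 f.
rewrite [cov _ (bd_op f) _]/cov mean_bd_op//.
set m := mean _ _; set x := ip _ (bd_op f) _; set y := dirichlet _ _ _.
have Hx : ip N.+1 f f = cov N.+1 f f + m * m by rewrite /cov subrK.
rewrite {}Hx; set z := cov _ _ _ => z0 zy xz.
have hz : h / (4 * C ^+ 2) * z <= h * y.
  rewrite mulrAC ler_pdivrMr ?mulr_gt0 ?exprn_gt0//.
  by rewrite -mulrA ler_wpM2l// mulrC.
have : (1 - h / (4 * C ^+ 2)) * z <= r * z by rewrite ler_wpM2r.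
by lra.
Qed.

Lemma cov_iter_bd_op_le N k f n : supported k f -> (k + n < N)%N ->
  cov N (iter n bd_op f) (iter n bd_op f) <= r ^+ n * cov N f f.
Proof.
move=> kf; elim: n => [|n IH] kN; first by rewrite expr0 mul1r.
case: N kN IH => // N kN IH; rewrite iterS.
apply: le_trans (cov_bd_op_le _) _; last first.
  by rewrite exprS -mulrA ler_wpM2l// IH//; lia.
by apply: (supportedW _ (iter_bd_op_supported (n := n) kf)); lia.
Qed.

(** The left side is a single term of the sum that the variance dominates, and the variance of a
    function with values in [0, 1] starts at most at 1. *)
Lemma iter_bd_op_cvg k f n i : supported k f ->
  (forall j, 0 <= f j <= 1) ->
  w i * (iter n bd_op f i - mean k f) ^+ 2 <= r ^+ n.
Proof.
move=> kf f01; pose N := (k + n + i).+1.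
rewrite -(@mean_widen k N)//; last by rewrite /N; lia.
rewrite -(@mean_iter_bd_op N f n k)//; last by rewrite /N; lia.
set g := iter n bd_op f.
apply: (@le_trans _ _ (cov N g g)).
  apply: le_trans (sum_sqr_dev_le_cov N g).
  have iN : (i < N)%N by rewrite /N; lia.
  rewrite (bigD1 (Ordinal iN))//= lerDl; apply: sumr_ge0 => j _.
  by apply: mulr_ge0; [exact: ltW|exact: sqr_ge0].
apply: le_trans (cov_iter_bd_op_le kf _) _; first by rewrite /N; lia.
rewrite ler_piMr ?exprn_ge0// /cov lerBlDr.
apply: (@le_trans _ _ 1); last by rewrite lerDl -expr2 sqr_ge0.
apply: le_trans (mass_le1 N); apply: ler_sum => j _.
have /andP[fj0 fj1] := f01 j.
by rewrite ler_piMr ?(ltW (w_gt0 _))// mulr_ile1.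
Qed.

End poincare.

(** Log-convexity makes the successive ratios nondecreasing. If the first one, [r], exceeded [s],
    then [psi m] would be at least [psi 0 * r ^+ m], which outgrows [M * s ^+ m]. *)
Lemma logconvex_ratio_le (psi : nat -> R) (M s : R) : 0 < s ->
  (forall m, 0 <= psi m) ->
  (forall m, psi m.+1 ^+ 2 <= psi m * psi m.+2) ->
  (forall m, psi m <= M * s ^+ m) ->
  psi 1%N <= s * psi 0%N.
Proof.
move=> s0 psi0 lc psiM; rewrite leNgt; apply/negP => ps.
have psi00 : 0 < psi 0%N.
  rewrite lt_neqAle psi0 andbT eq_sym; apply/eqP => p0.
  move: (lc 0%N) ps; rewrite p0 mul0r mulr0 => lc0 ps.
  by move: lc0; rewrite leNgt exprn_gt0.
pose r := psi 1%N / psi 0%N.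
have sr : s < r by rewrite ltr_pdivlMr.
have r0 : 0 < r by exact: lt_trans sr.
have H m : 0 < psi m /\ r * psi m <= psi m.+1.
  elim: m => [|m [pm IH]]; first by rewrite /r divfK ?gt_eqF.
  have pm1 : 0 < psi m.+1 by apply: lt_le_trans IH; rewrite mulr_gt0.
  split=> //; rewrite -(ler_pM2l pm); apply: le_trans (lc m).
  by rewrite expr2 mulrCA mulrA ler_pM2r.
have G m : psi 0%N * r ^+ m <= psi m.
  elim: m => [|m IH]; first by rewrite expr0 mulr1.
  have [_] := H m; apply: le_trans.
  by rewrite exprS mulrCA ler_pM2l.
have sr01 : 0 <= s / r < 1.
  by rewrite divr_ge0 ?ltW// ltr_pdivrMr// mul1r.
have [N /(_ N (leqnn _))] := geometric_lt M sr01 psi00.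
rewrite expr_div_n mulrA ltr_pdivrMr ?exprn_gt0// ltNge.
by rewrite (le_trans (G N)).
Qed.

(** * Return probabilities of a single state *)

Definition delta (i j : nat) : R := (j == i)%:R.

Lemma delta_supported i : supported i.+1 (delta i).
Proof. by move=> j ij; rewrite /delta gtn_eqF. Qed.

Lemma mean_delta N i : (i < N)%N -> mean N (delta i) = w i.
Proof.
move=> iN; rewrite /mean (bigD1 (Ordinal iN))//= {1}/delta eqxx mulr1.
rewrite big1 ?addr0// => j; rewrite -val_eqE/= /delta => /negbTE ->.
by rewrite mulr0.
Qed.

Lemma ip_delta N i f : (i < N)%N -> ip N (delta i) f = w i * f i.
Proof.
move=> iN; rewrite /ip (bigD1 (Ordinal iN))//= {1}/delta eqxx mul1r.
rewrite big1 ?addr0// => j; rewrite -val_eqE/= /delta => /negbTE ->.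
by rewrite mul0r mulr0.
Qed.

Lemma iter_bd_op_sym N k f g n : supported k f -> supported k g ->
  (k + n <= N)%N -> ip N g (iter n bd_op f) = ip N (iter n bd_op g) f.
Proof.
elim: n k g => // n IH k g kf kg kN.
rewrite iterS bd_op_sym; last 2 first.
- by apply: (supportedW _ (iter_bd_op_supported (n := n) kf)); lia.
- by apply: (supportedW _ kg); lia.
rewrite (IH k.+1); first by rewrite -iterSr.
- exact: (supportedW _ kf).
- exact: bd_op_supported.
- by lia.
Qed.

Definition return_prob i n : R := iter n bd_op (delta i) i.

(** Self-adjointness moves all the steps to one side, so only [m + n] matters; by stationarity both
    means are [w i]. *)
Lemma cov_iter_delta N i m n : (i.+1 + (m + n) <= N)%N ->
  cov N (iter m bd_op (delta i)) (iter n bd_op (delta i)) =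
  w i * return_prob i (m + n) - w i * w i.
Proof.
move=> iN; have iN' : (i < N)%N by lia.
have di := @delta_supported i.
rewrite /cov !(mean_iter_bd_op di) ?mean_delta//; [|lia..].
congr (_ - _); rewrite -(@iter_bd_op_sym _ (i.+1 + n)); last 3 first.
- by apply: (supportedW _ (iter_bd_op_supported (n := n) di)).
- by apply: (supportedW _ di); lia.
- by lia.
by rewrite ip_delta// -iterD.
Qed.

(** The variance [psi m] after [m] steps is log-convex: the covariance between steps [m] and [m + 2]
    is [psi m.+1]. It involves the return probability at time [2m], hence the rate [t ^+ 2]. *)
Lemma return_prob_ratio i (M t : R) : 0 < t ->
  (forall n, `|return_prob i n - w i| <= M * t ^+ n) ->
  return_prob i 2 - w i <= t ^+ 2 * (1 - w i).
Proof.
move=> t0 H; have wi := w_gt0 i.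
pose psi m := w i * return_prob i (m + m) - w i * w i.
have psiE m : psi m = cov (i.+1 + (m + m)) (iter m bd_op (delta i))
    (iter m bd_op (delta i)) by rewrite cov_iter_delta.
suff : psi 1%N <= t ^+ 2 * psi 0%N.
  have -> : psi 0%N = w i * (1 - w i).
    by rewrite /psi /return_prob/= /delta eqxx mulrBr.
  by rewrite /psi -mulrBr mulrCA ler_pM2l.
apply: (@logconvex_ratio_le psi (w i * M)).
- by rewrite exprn_gt0.
- by move=> m; rewrite psiE cov_ge0.
- move=> m; pose N := (i.+1 + (m + 2 + (m + 2)))%N.
  have := cov_cauchy_schwarz N (iter m bd_op (delta i))
    (iter (m + 2) bd_op (delta i)).
  rewrite !cov_iter_delta; [|by rewrite /N; lia..].
  rewrite /psi (_ : (m + (m + 2))%N = (m.+1 + m.+1)%N); last by lia.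
  by rewrite (_ : (m + 2)%N = m.+2)//; lia.
- move=> m; rewrite /psi -mulrBr -mulrA ler_pM2l// -exprM mul2n -addnn.
  exact: le_trans (ler_norm _) (H _).
Qed.

Lemma bd_op_ge f i : (forall j, 0 <= f j) ->
  (1 - exit_prob i) * f i <= bd_op f i.
Proof.
move=> f0; rewrite -subr_ge0.
have -> : bd_op f i - (1 - exit_prob i) * f i =
    (c i.+1 * f i.+1 + c i * f i.-1) / w i.
  by rewrite /bd_op /exit_prob; field; rewrite gt_eqF.
by apply: divr_ge0; [rewrite addr_ge0// mulr_ge0|exact: ltW].
Qed.

(** Holding twice is one way of being back after two steps. *)
Lemma exit_prob_ratio i (M t : R) : 0 < t ->
  (forall n, `|return_prob i n - w i| <= M * t ^+ n) ->
  (1 - exit_prob i) ^+ 2 <= t ^+ 2 + w i.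
Proof.
move=> t0 H; have := return_prob_ratio t0 H; have wi := w_gt0 i.
have e1 : 0 <= 1 - exit_prob i.
  by rewrite subr_ge0 ler_pdivrMr// mul1r.
have d0 j : 0 <= delta i j by rewrite ler0n.
have := bd_op_ge i (bd_op_ge0 d0); have := ler_wpM2l e1 (bd_op_ge i d0).
rewrite {1}/delta eqxx mulr1 /return_prob/= -expr2.
have : 0 <= t ^+ 2 * w i by rewrite mulr_ge0 ?sqr_ge0// ltW.
by lra.
Qed.

Lemma iter_bd_op_far f i n : (forall j, (j <= i + n)%N -> f j = 0) ->
  iter n bd_op f i = 0.
Proof.
elim: n i => [|n IH] i fi /=; first by rewrite fi ?addn0.
by rewrite /bd_op !IH ?subrr ?mulr0 ?add0r ?mulr0 ?mul0r//= => j ji; apply: fi; lia.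
Qed.

End birth_death.

(** * Kernels, sums over countable sets and total variation *)

Section esum_extra.
Context {R : realType}.
Local Open Scope ereal_scope.

Lemma esumZl {T : choiceType} (A : set T) (f : T -> \bar R) (r : R) :
  (0 <= r)%R -> (forall i, A i -> 0 <= f i) ->
  \esum_(i in A) (r%:E * f i) = r%:E * \esum_(i in A) f i.
Proof.
move=> r0 f0; rewrite /esum -ereal_supZl//; last first.
  by apply/set0P; exists 0; exists set0; [exact: fsets_set0|rewrite fsbig_set0].
congr ereal_sup; rewrite image_comp; apply: eq_imagel => X [finX XA] /=.
rewrite !fsbig_finite//= big_seq [in RHS]big_seq ge0_sume_distrr// => i.
by rewrite in_fset_set// inE => /XA/f0.
Qed.

Lemma esum_pick {T : choiceType} (A : set T) (f : T -> \bar R) v :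
  A v -> 0 <= f v -> (forall u, A u -> u != v -> f u = 0) ->
  \esum_(u in A) f u = f v.
Proof.
move=> Av fv fu; rewrite (esumID [set v]) => [|u Au]; last first.
  by have [->//|/(fu _ Au) ->] := eqVneq u v.
rewrite (_ : A `&` [set v] = [set v]) ?esum_set1//; last first.
  by apply: setIidr => _ ->.
by rewrite esum1 ?adde0// => u [Au /eqP]; exact: fu.
Qed.

Lemma esum_exchange {T U : choiceType} (A : set T) (B : set U)
    (f : T -> U -> \bar R) : (forall i j, A i -> B j -> 0 <= f i j) ->
  \esum_(i in A) \esum_(j in B) f i j = \esum_(j in B) \esum_(i in A) f i j.
Proof.
move=> f0; rewrite !esum_esum//; last by move=> i j Bi Aj; exact: f0.
rewrite (@reindex_esum _ _ _ (B `*`` (fun=> A)) _ (fun k => (k.2, k.1)))//.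
split.
- by move=> [i j] [].
- by move=> [i j] [i' j'] _ _ /= [-> ->].
- by move=> [i j] [/= Ai Bj]; exists (j, i).
Qed.

End esum_extra.

Section kernel_operator.
Context {R : realType} {T : choiceType} (Z : set T) (P : T -> T -> \bar R).
Variable K : (T -> R) -> T -> R.
Local Open Scope ereal_scope.
Hypothesis P_ge0 : forall z u, Z z -> Z u -> 0 <= P z u.
Hypothesis K_esum : forall f, (forall u, Z u -> 0 <= f u)%R ->
  forall z, Z z -> \esum_(u in Z) (P z u * (f u)%:E) = (K f z)%:E.

(** Against the indicator of [u] the sum in [K_esum] has one nonzero term, and its value is real. *)
Lemma kernel_fin_num z u : Z z -> Z u -> P z u \is a fin_num.
Proof.
move=> Zz Zu; have : \esum_(v in Z) (P z v * (\1_[set u] v)%:E) \is a fin_num.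
  by rewrite K_esum// => v _; rewrite indicE ler0n.
rewrite (esum_pick (v := u)) ?indicE ?mem_set ?mule1 ?P_ge0// => v _ /eqP vu.
by rewrite indicE memNset ?mule0.
Qed.

Lemma iter_kernel_ge0 f n : (forall u, Z u -> 0 <= f u)%R ->
  forall z, Z z -> (0 <= iter n K f z)%R.
Proof.
move=> f0; elim: n => //= n IH z Zz; rewrite -lee_fin -K_esum//.
by apply: esum_ge0 => u Zu; rewrite mule_ge0 ?P_ge0// lee_fin IH.
Qed.

Lemma nstep_ge0 n z u : Z z -> Z u -> 0 <= nstep Z P n z u.
Proof.
elim: n z => [|n IH] z Zz Zu /=; first by rewrite lee_fin ler0n.
by apply: esum_ge0 => v Zv; rewrite mule_ge0 ?P_ge0 ?IH.
Qed.

(** The bridge from kernels to operators: exchanging sums turns the first-step recursion of [nstep]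
    into iteration of [K] on an indicator. *)
Lemma mass_nstep n A z : A `<=` Z -> Z z ->
  mass (nstep Z P n z) A = (iter n K \1_A z)%:E.
Proof.
move=> AZ; elim: n z => [|n IH] z Zz; rewrite /mass /=.
  have [Az|Az] := pselect (A z).
    rewrite (esum_pick (v := z)) ?eqxx ?indicE ?mem_set ?lee_fin//.
    by move=> u _; rewrite eq_sym => /negbTE ->.
  rewrite esum1 ?indicE ?memNset// => u Au.
  by case: eqP => // zu; move: Az; rewrite zu.
rewrite esum_exchange => [|u v Au Zv]; last first.
  by rewrite mule_ge0 ?P_ge0// nstep_ge0//; exact: AZ.
rewrite -K_esum//; last by apply: iter_kernel_ge0 => u _; rewrite indicE ler0n.
apply: eq_esum => u Zu; rewrite -IH// -(fineK (kernel_fin_num Zz Zu)).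
rewrite esumZl//; first by rewrite fine_ge0 ?P_ge0.
by move=> v /AZ; exact: nstep_ge0.
Qed.

Lemma mass_finite_le (f g : T -> \bar R) (e : R) A :
  A `<=` Z -> (forall u, Z u -> 0 <= g u) ->
  (forall F, finite_set F -> F `<=` Z -> mass f F <= mass g F + e%:E) ->
  (forall u, Z u -> 0 <= f u) ->
  mass f A <= mass g A + e%:E.
Proof.
move=> AZ g0 fg f0; apply: ge_ereal_sup => _ [X [finX XA] <-].
have XZ := subset_trans XA AZ.
rewrite -esum_fset//; last by move=> i /[!inE] /XZ; exact: f0.
apply: le_trans (fg X finX XZ) _; rewrite leeD2r//.
rewrite /mass esum_fset//; last by move=> i /[!inE] /XZ; exact: g0.
by apply: esum_ge; exists X.
Qed.

Variable w : T -> \bar R.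
Hypothesis w_ge0 : forall u, Z u -> 0 <= w u.
Hypothesis w_fin : mass w Z \is a fin_num.

Lemma mass_subset A : A `<=` Z -> mass w A <= mass w Z.
Proof.
move=> AZ; apply: ge_ereal_sup => _ [X [finX XA] <-].
by apply: esum_ge; exists X => //; split=> //; exact: subset_trans XA AZ.
Qed.

Lemma mass_fin_num A : A `<=` Z -> mass w A \is a fin_num.
Proof.
move=> AZ; rewrite ge0_fin_numE; last by apply: esum_ge0 => u /AZ; exact: w_ge0.
by apply: le_lt_trans (mass_subset AZ) _; rewrite ltey_eq w_fin.
Qed.

(** Masses are suprema over finite subsets, so each of the two one-sided bounds extends from finite
    events to all. Finite events are those whose indicators have finite support, as the variance
    estimates require. *)
Lemma tv_dist_nstep_le n z (e : R) : Z z ->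
  (forall F, finite_set F -> F `<=` Z ->
    `|iter n K \1_F z - fine (mass w F)| <= e)%R ->
  tv_dist Z (nstep Z P n z) w <= e%:E.
Proof.
move=> Zz H; apply: ge_ereal_sup => _ [A AZ <-].
have {}H F : finite_set F -> F `<=` Z ->
    mass (nstep Z P n z) F <= mass w F + e%:E /\
    mass w F <= mass (nstep Z P n z) F + e%:E.
  move=> finF FZ; have := H F finF FZ; rewrite mass_nstep//.
  rewrite -(fineK (mass_fin_num FZ)) -!EFinD !lee_fin ler_distl.
  by move=> /andP[? ?]; split; lra.
have := @mass_finite_le _ _ e A AZ w_ge0 (fun F fF FZ => (H F fF FZ).1)
  (fun u => nstep_ge0 n Zz).
have := @mass_finite_le _ _ e A AZ (fun u => nstep_ge0 n Zz)
  (fun F fF FZ => (H F fF FZ).2) w_ge0.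
rewrite mass_nstep// -(fineK (mass_fin_num AZ)) -EFinB abse_EFin -!EFinD !lee_fin.
by move=> ? ?; rewrite ler_distl; apply/andP; split; lra.
Qed.

Lemma geometrically_ergodic_finite :
  (exists (M : T -> R) (t : R), (0 < t < 1)%R /\
    forall z n F, Z z -> finite_set F -> F `<=` Z ->
    (`|iter n K \1_F z - fine (mass w F)| <= M z * t ^+ n)%R) ->
  geometrically_ergodic Z P w.
Proof.
move=> [M [t [t01 H]]]; exists M, t; split=> // z n Zz.
by apply: tv_dist_nstep_le => // F; exact: H.
Qed.

Lemma geometrically_ergodic_dist : geometrically_ergodic Z P w ->
  exists (M : T -> R) (t : R), (0 < t < 1)%R /\
    forall z n A, Z z -> A `<=` Z ->
    (`|iter n K \1_A z - fine (mass w A)| <= M z * t ^+ n)%R.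
Proof.
move=> [M [t [t01 H]]]; exists M, t; split=> // z n A Zz AZ.
rewrite -lee_fin; apply: le_trans (H z n Zz).
apply: ereal_sup_ubound; exists A => //.
by rewrite mass_nstep// -[in LHS](fineK (mass_fin_num AZ)).
Qed.

End kernel_operator.

(** * Distributions carried by an injective path *)

Section weighted_path.
Context {R : realType} {T : choiceType} (s : nat -> T) (m : nat -> R).
Variable w : T -> \bar R.
Variable Z : set T.
Hypothesis s_inj : injective s.
Hypothesis Zs : forall j, Z (s j).
Hypothesis ws : forall j, w (s j) = (m j)%:E.
Hypothesis w0 : forall z, Z z -> ~ range s z -> w z = 0%E.
Hypothesis m_ge0 : forall j, 0 <= m j.
Hypothesis m_le1 : forall N, \sum_(j < N) m j <= 1.

Lemma weight_ge0 z : Z z -> (0 <= w z)%E.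
Proof.
move=> Zz; have [[j _ <-]|/w0 ->//] := pselect (range s z).
by rewrite ws lee_fin.
Qed.

Lemma finite_path_bounded F : finite_set F ->
  exists k, forall j, (k <= j)%N -> ~ F (s j).
Proof.
move=> finF; have : finite_set (s @^-1` F).
  by apply: finite_preimage => // i j _ _; exact: s_inj.
move=> /finite_seqP[X FX]; exists (\max_(j <- X) j).+1 => j kj Fj.
have jX : j \in X by have : (s @^-1` F) j by []; rewrite FX.
by move: kj; rewrite ltnNge (@leq_bigmax_seq _ _ xpredT id).
Qed.

Lemma mass_path A k : A `<=` Z -> (forall j, (k <= j)%N -> ~ A (s j)) ->
  mass w A = (\sum_(j < k) m j * \1_A (s j))%:E.
Proof.
move=> AZ Ak; rewrite /mass (esumID (range s)) => [|z /AZ/weight_ge0//].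
rewrite [X in (_ + X)%E]esum1 ?adde0; last by move=> z [/AZ Zz /w0 ->].
rewrite (_ : A `&` range s = s @` (`I_k `&` s @^-1` A)); last first.
  apply/seteqP; split=> [z [Az [j _ jz]]|z [j [jk Aj] <-]]; last by split.
  exists j => //; split; last by rewrite /= jz.
  by rewrite /= ltnNge; apply/negP => /Ak; rewrite jz.
rewrite esum_image => [|i j _ _]; last exact: s_inj.
rewrite esum_mkcondr esum_fset//; last first.
  by move=> j _; case: ifP => // _; rewrite ws lee_fin.
rewrite -fsbig_ord -sumEFin; apply: eq_bigr => j _.
rewrite indicE ws; have [Aj|Aj] := pselect (A (s j)).
  by rewrite !mem_set// mulr1.
by rewrite !memNset// mulr0.
Qed.

Lemma mass_path_le1 : (mass w Z <= 1)%E.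
Proof.
apply: ge_ereal_sup => _ [F [finF FZ] <-].
rewrite -esum_fset// => [|z /[!inE] /FZ/weight_ge0//].
have [k Fk] := finite_path_bounded finF.
have := mass_path FZ Fk; rewrite /mass => ->; rewrite lee_fin.
apply: le_trans (m_le1 k); apply: ler_sum => j _.
by rewrite ler_piMr// indicE; case: (_ \in _).
Qed.

Lemma mass_path_fin_num : mass w Z \is a fin_num.
Proof.
rewrite ge0_fin_numE; last by apply: esum_ge0 => z; exact: weight_ge0.
by apply: le_lt_trans mass_path_le1 _; rewrite ltry.
Qed.

End weighted_path.

(** * Geometric convergence of birth-death chains, in both directions *)

Section birth_death_ergodicity.
Context {R : realType} (w c : nat -> R).
Hypothesis w_gt0 : forall j, 0 < w j.
Hypothesis c0 : c 0%N = 0.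
Hypothesis c_ge0 : forall j, 0 <= c j.
Hypothesis exit_le1 : forall j, c j + c j.+1 <= w j.
Hypothesis mass_le1 : forall N, \sum_(j < N) w j <= 1.

Lemma bd_op_geometric (V : nat -> R) (C h : R) : 0 < C -> 0 < h ->
  (forall j, 0 <= V j) -> (forall j, w j <= V j - V j.+1) ->
  (forall j, V j.+1 <= C * c j.+1) ->
  (forall e, 0 < e -> exists N, 1 - e <= \sum_(j < N) w j) ->
  (forall j, exit_prob w c j + exit_prob w c j.+1 <= 2 - h) ->
  exists t, 0 < t < 1 /\ forall k f n i, supported k f ->
    (forall j, 0 <= f j <= 1) ->
    `|iter n (bd_op w c) f i - mean w k f| <= t ^+ n / Num.sqrt (w i).
Proof.
(* The floor 1/2 keeps [r] positive. Since [r] contracts squares, the rate is its square root. *)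
move=> C0 h0 V0 Vw Vc m1 eh; pose r := Num.max (1 - h / (4 * C ^+ 2)) 2^-1.
have r0 : 0 < r by rewrite lt_max invr_gt0 ltr0n orbT.
have r1 : r < 1.
  rewrite gt_max ltrBlDr ltrDl divr_gt0 ?mulr_gt0 ?exprn_gt0//=.
  by rewrite invf_lt1// ltr1n.
exists (Num.sqrt r); split.
  by rewrite sqrtr_gt0 r0 -[ltRHS]sqrtr1 ltr_sqrt.
move=> k f n i kf f01; have wi := w_gt0 i.
rewrite ler_pdivlMr ?sqrtr_gt0// -ler_sqr ?nnegrE; last 2 first.
- by rewrite mulr_ge0// sqrtr_ge0.
- by rewrite exprn_ge0// sqrtr_ge0.
rewrite exprMn -exprM mulnC exprM !sqr_sqrtr ?(ltW r0) ?(ltW wi)// real_normK ?num_real//.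
rewrite mulrC; apply: (@iter_bd_op_cvg _ _ _ w_gt0 c0 c_ge0 exit_le1 mass_le1
  V C C0 V0 Vw Vc m1 h r eh (ltW h0)) => //; last exact: ltW.
by rewrite le_max lexx.
Qed.

Lemma geometric_bd_op (M : nat -> R) (t : R) : 0 < t < 1 ->
  (forall i j n, `|iter n (bd_op w c) (delta j) i - w j| <= M i * t ^+ n) ->
  (forall n, w n.+1 <= M 0%N * t ^+ n) /\
  exists2 e, 0 < e & exists N, forall i, (N <= i)%N -> e <= exit_prob w c i.
Proof.
move=> /andP[t0 t1] H.
(* From 0, the state [n.+1] is out of reach within [n] steps, so the error there is its whole
   mass. *)
have w_le n : w n.+1 <= M 0%N * t ^+ n.
  have := H 0%N n.+1 n; rewrite iter_bd_op_far ?sub0r ?normrN.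
    exact: le_trans (ler_norm _).
  by move=> j; rewrite add0n => jn; rewrite /delta ltn_eqF.
split=> //.
have t01 : 0 <= t < 1 by rewrite ltW.
(* This number is [((1 + t) / 2) ^+ 2 - t ^+ 2]: an exit probability below [(1 - t) / 2] would make
   the left side of [exit_prob_ratio] exceed [t ^+ 2] by more than that, while the mass is
   eventually smaller. *)
have d0 : 0 < (1 - t) * (1 + 3 * t) / 4 by rewrite divr_gt0 ?mulr_gt0//; lra.
have [N NH] := geometric_lt (M 0%N) t01 d0.
exists ((1 - t) / 2); first by rewrite divr_gt0//; lra.
exists N.+1 => -[//|i] Ni; rewrite leNgt; apply/negP => ei.
have := exit_prob_ratio w_gt0 c0 c_ge0 exit_le1 mass_le1 t0 (H i.+1 i.+1).
have := le_lt_trans (w_le i) (NH i Ni); nra.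
Qed.

End birth_death_ergodicity.

Lemma indic01 {R : realType} {T : Type} (A : set T) z : 0 <= (\1_A z : R) <= 1.
Proof. by rewrite indicE; case: (_ \in _); rewrite ?lexx ?ler01. Qed.

(** * The Gibbs samplers *)

Section gibbs_operators.
Context {R : realType} (a b : nat -> R).
Hypothesis a_gt0 : forall i, (0 < i)%N -> 0 < a i.
Hypothesis b_gt0 : forall i, (0 < i)%N -> 0 < b i.
Hypothesis b0 : b 0%N = 0.
Implicit Types (f g : nat -> R) (F : nat * nat -> R).

Definition mean_XgY f y : R := (a y * f y + b y * f y.+1) / pi_Y a b y.
(** At [x = 1] the value [g 0], outside the state space, enters with weight [b 0 = 0]. *)
Definition mean_YgX g x : R := (a x * g x + b x.-1 * g x.-1) / pi_X a b x.

Definition op_X f : nat -> R := mean_YgX (mean_XgY f).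
Definition op_DGS F (z : nat * nat) : R :=
  mean_XgY (fun x => mean_YgX (fun y => F (x, y)) x) z.2.
Definition op_RGS (p : R) F (z : nat * nat) : R :=
  p * mean_XgY (fun x => F (x, z.2)) z.2 +
  (1 - p) * mean_YgX (fun y => F (z.1, y)) z.1.

Lemma b_ge0 i : 0 <= b i.
Proof. by case: i => [|i]; rewrite ?b0// ltW// b_gt0. Qed.

Lemma pi_X_gt0 x : (0 < x)%N -> 0 < pi_X a b x.
Proof. by move=> x0; rewrite ltr_wpDr ?b_ge0 ?a_gt0. Qed.

Lemma pi_Y_gt0 y : (0 < y)%N -> 0 < pi_Y a b y.
Proof. by move=> y0; rewrite addr_gt0 ?b_gt0 ?a_gt0. Qed.

Lemma pi_XgY_ge0 x y : (0 < x)%N -> (0 < y)%N -> 0 <= pi_XgY a b x y.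
Proof.
by move=> x0 y0; apply: divr_ge0; [exact: pi_joint_ge0|exact/ltW/pi_Y_gt0].
Qed.

Lemma pi_YgX_ge0 x y : (0 < x)%N -> 0 <= pi_YgX a b y x.
Proof.
by move=> x0; apply: divr_ge0; [exact: pi_joint_ge0|exact/ltW/pi_X_gt0].
Qed.

Lemma mean_XgY_ge0 f : (forall x, posnat x -> 0 <= f x) ->
  forall y, posnat y -> 0 <= mean_XgY f y.
Proof.
move=> f0 y y0; rewrite divr_ge0 ?(ltW (pi_Y_gt0 _))// addr_ge0// mulr_ge0 ?b_ge0 ?f0//.
exact/ltW/a_gt0.
Qed.

Lemma mean_YgX_ge0 g : (forall y, posnat y -> 0 <= g y) ->
  forall x, posnat x -> 0 <= mean_YgX g x.
Proof.
move=> g0 x x0; rewrite divr_ge0 ?(ltW (pi_X_gt0 _))// addr_ge0//.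
  by rewrite mulr_ge0 ?g0// ltW// a_gt0.
by case: x x0 => [//|[|x]] _ /=; rewrite ?b0 ?mul0r// mulr_ge0 ?b_ge0// g0.
Qed.

Local Open Scope ereal_scope.

Lemma mean_XgY_esum f : (forall x, posnat x -> 0 <= f x)%R ->
  forall y, posnat y ->
  \esum_(x in posnat) (pi_XgY a b x y * f x)%:E = (mean_XgY f y)%:E.
Proof.
move=> f0 y y0; have yy : (y.+1 == y) = false by rewrite gtn_eqF.
have p0 x : posnat x -> 0 <= (pi_XgY a b x y * f x)%:E.
  by move=> x0; rewrite lee_fin mulr_ge0 ?f0 ?pi_XgY_ge0.
rewrite (esumID [set y])//.
rewrite (_ : _ `&` [set y] = [set y]) ?esum_set1 ?p0//; last first.
  by apply: setIidr => _ ->.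
rewrite (esum_pick (v := y.+1)) ?p0//.
- rewrite /pi_XgY /pi_joint eqxx yy eqxx -EFinD; congr EFin.
  by rewrite /mean_XgY; ring.
- by split=> //=; apply/eqP; rewrite yy.
- move=> x [_ /eqP xy] /negbTE xy1; rewrite /pi_XgY /pi_joint xy1.
  by rewrite (negbTE xy) !mul0r.
Qed.

Lemma mean_YgX_esum g : (forall y, posnat y -> 0 <= g y)%R ->
  forall x, posnat x ->
  \esum_(y in posnat) (pi_YgX a b y x * g y)%:E = (mean_YgX g x)%:E.
Proof.
move=> g0 x x0; have xx : (x == x.-1) = false by case: x x0 => // x _; rewrite gtn_eqF.
have p0 y : posnat y -> 0 <= (pi_YgX a b y x * g y)%:E.
  by move=> y0; rewrite lee_fin mulr_ge0 ?g0 ?pi_YgX_ge0.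
rewrite (esumID [set x])//.
rewrite (_ : _ `&` [set x] = [set x]) ?esum_set1 ?p0//; last first.
  by apply: setIidr => _ ->.
have off y : y != x -> y != x.-1 -> (pi_YgX a b y x * g y)%:E = 0.
  move=> yx yx1; rewrite /pi_YgX /pi_joint eq_sym (negbTE yx).
  case: eqP => xy; last by rewrite !mul0r.
  by move: yx1; rewrite xy eqxx.
have -> : \esum_(y in posnat `&` ~` [set x]) (pi_YgX a b y x * g y)%:E =
    (b x.-1 / pi_X a b x * g x.-1)%:E.
  have [x1|x1] := eqVneq x 1%N.
    rewrite esum1; first by rewrite x1 b0 !mul0r.
    by move=> y [y0 /eqP yx]; apply: off => //; rewrite x1 -lt0n.
  rewrite (esum_pick (v := x.-1)).
  - by rewrite /pi_YgX /pi_joint xx prednK ?eqxx.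
  - by split; [rewrite /posnat/=; lia|apply/eqP; rewrite eq_sym xx].
  - by rewrite p0// /posnat/=; lia.
  - by move=> y [_ /eqP]; exact: off.
rewrite /pi_YgX /pi_joint eqxx -EFinD; congr EFin.
by rewrite /mean_YgX; ring.
Qed.

Lemma k_X_ge0 x x' : posnat x -> posnat x' -> 0 <= k_X a b x x'.
Proof.
move=> x0 x'0; apply: esum_ge0 => y y0.
by rewrite lee_fin mulr_ge0 ?pi_XgY_ge0 ?pi_YgX_ge0.
Qed.

Lemma k_DGS_ge0 z z' : (posnat `*` posnat) z -> (posnat `*` posnat) z' ->
  0 <= k_DGS a b z z'.
Proof.
move=> [z1 z2] [z'1 z'2].
by rewrite lee_fin mulr_ge0 ?pi_XgY_ge0 ?pi_YgX_ge0.
Qed.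

Lemma k_RGS_ge0 p z z' : (0 < p < 1)%R ->
  (posnat `*` posnat) z -> (posnat `*` posnat) z' -> 0 <= k_RGS a b p z z'.
Proof.
move=> /andP[p0 p1] [z1 z2] [z'1 z'2].
rewrite lee_fin addr_ge0// mulr_ge0 ?(ltW p0) ?subr_ge0 ?(ltW p1)//.
  by rewrite mulr_ge0 ?pi_XgY_ge0 ?ler0n.
by rewrite mulr_ge0 ?pi_YgX_ge0 ?ler0n.
Qed.

Lemma op_X_esum f : (forall x, posnat x -> 0 <= f x)%R -> forall x, posnat x ->
  \esum_(u in posnat) (k_X a b x u * (f u)%:E) = (op_X f x)%:E.
Proof.
move=> f0 x x0; rewrite -mean_YgX_esum//; last exact: mean_XgY_ge0.
transitivity (\esum_(u in posnat) \esum_(y in posnat)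
    (pi_YgX a b y x * (pi_XgY a b u y * f u))%:E).
  apply: eq_esum => u u0; rewrite muleC -esumZl ?f0//; last first.
    by move=> y y0; rewrite lee_fin mulr_ge0 ?pi_XgY_ge0 ?pi_YgX_ge0.
  by apply: eq_esum => y _; rewrite -EFinM; congr EFin; ring.
rewrite esum_exchange => [|u y u0 y0]; last first.
  by rewrite lee_fin mulr_ge0 ?pi_YgX_ge0// mulr_ge0 ?pi_XgY_ge0 ?f0.
apply: eq_esum => y y0; rewrite EFinM -mean_XgY_esum// -esumZl ?pi_YgX_ge0//.
by move=> u u0; rewrite lee_fin mulr_ge0 ?pi_XgY_ge0 ?f0.
Qed.

Lemma esum_posnat2 (H : nat * nat -> \bar R) :
  (forall z, (posnat `*` posnat) z -> 0 <= H z) ->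
  \esum_(z in posnat `*` posnat) H z =
  \esum_(x in posnat) \esum_(y in posnat) H (x, y).
Proof.
move=> H0; rewrite (esum_esum (J := fun=> posnat)).
  by apply: eq_esum => -[].
by move=> x y x0 y0; rewrite H0.
Qed.

Lemma op_DGS_esum F : (forall z, (posnat `*` posnat) z -> 0 <= F z)%R ->
  forall z, (posnat `*` posnat) z ->
  \esum_(u in posnat `*` posnat) (k_DGS a b z u * (F u)%:E) = (op_DGS F z)%:E.
Proof.
move=> F0 z [z1 z2]; rewrite esum_posnat2; last first.
  by move=> u Zu; rewrite mule_ge0 ?k_DGS_ge0 ?lee_fin ?F0.
have F0' x : posnat x -> forall y, posnat y -> (0 <= F (x, y))%R.
  by move=> x0 y y0; exact: F0.
rewrite /op_DGS -mean_XgY_esum//; last first.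
  by move=> x x0; apply: mean_YgX_ge0 => //; exact: F0'.
apply: eq_esum => x x0; rewrite EFinM -mean_YgX_esum//; last exact: F0'.
rewrite -esumZl ?pi_XgY_ge0//; last first.
  by move=> y y0; rewrite lee_fin mulr_ge0 ?pi_YgX_ge0 ?F0'.
by apply: eq_esum => y _; rewrite -!EFinM; congr EFin; rewrite /=; ring.
Qed.

Lemma op_RGS_esum p F : (0 < p < 1)%R ->
  (forall z, (posnat `*` posnat) z -> 0 <= F z)%R ->
  forall z, (posnat `*` posnat) z ->
  \esum_(u in posnat `*` posnat) (k_RGS a b p z u * (F u)%:E) =
  (op_RGS p F z)%:E.
Proof.
move=> p01 F0 z [z1 z2]; have /andP[p0 p1] := p01.
have q0 : (0 <= 1 - p)%R by rewrite subr_ge0 ltW.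
have F0' x : posnat x -> forall y, posnat y -> (0 <= F (x, y))%R.
  by move=> x0 y y0; exact: F0.
rewrite esum_posnat2; last first.
  by move=> u Zu; rewrite mule_ge0 ?k_RGS_ge0 ?lee_fin ?F0.
(* The kernel is split into the update of [x], where [y] is frozen, and that of [y], where [x] is
   frozen; in each part one of the two sums collapses to a single term. *)
pose G x y : \bar R := (p * (pi_XgY a b x z.2 * F (x, y)) * (y == z.2)%:R)%:E.
pose H x y : \bar R := ((1 - p) * (pi_YgX a b y z.1 * F (x, y)) * (x == z.1)%:R)%:E.
have G0 x y : posnat x -> posnat y -> 0 <= G x y.
  by move=> x0 y0; rewrite lee_fin mulr_ge0// mulr_ge0 ?(ltW p0)// mulr_ge0 ?pi_XgY_ge0 ?F0'.
have H0 x y : posnat x -> posnat y -> 0 <= H x y.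
  by move=> x0 y0; rewrite lee_fin mulr_ge0// mulr_ge0// mulr_ge0 ?pi_YgX_ge0 ?F0'.
transitivity (\esum_(x in posnat) (\esum_(y in posnat) G x y +
    \esum_(y in posnat) H x y)).
  apply: eq_esum => x x0; rewrite -esumD//; first last.
  - by move=> y; exact: H0.
  - by move=> y; exact: G0.
  by apply: eq_esum => y _; rewrite /G /H -EFinM -EFinD; congr EFin => /=; ring.
rewrite esumD; last 2 first.
- by move=> x x0; apply: esum_ge0 => y; exact: G0.
- by move=> x x0; apply: esum_ge0 => y; exact: H0.
rewrite /op_RGS EFinD; congr (_ + _).
- rewrite EFinM -mean_XgY_esum => [|x x0|//]; last exact: F0'.
  rewrite -esumZl ?(ltW p0)//; last first.
    by move=> x x0; rewrite lee_fin mulr_ge0 ?pi_XgY_ge0 ?F0'.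
  apply: eq_esum => x x0; rewrite (esum_pick (v := z.2)) ?G0//.
    by rewrite /G eqxx mulr1 EFinM.
  by move=> y _ /negbTE yz; rewrite /G yz mulr0.
- rewrite EFinM -mean_YgX_esum => [|y y0|//]; last exact: F0'.
  rewrite -esumZl//; last first.
    by move=> y y0; rewrite lee_fin mulr_ge0 ?pi_YgX_ge0 ?F0'.
  rewrite (esum_pick (v := z.1))//; last 2 first.
  - by apply: esum_ge0 => y; exact: H0.
  - move=> x _ /negbTE xz; rewrite esum1// => y _.
    by rewrite /H xz mulr0.
  by apply: eq_esum => y _; rewrite /H eqxx mulr1 EFinM.
Qed.

End gibbs_operators.

Lemma sum_lt_monotone {R : realType} (u : nat -> R) m n : (forall j, 0 <= u j) ->
  (m <= n)%N -> \sum_(j < m) u j <= \sum_(j < n) u j.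
Proof.
move=> u0; elim: n => [|n IH]; first by rewrite leqn0 => /eqP ->.
rewrite leq_eqVlt => /predU1P[->//|/IH mn].
by rewrite big_ord_recr/= ler_wpDr.
Qed.

Lemma mean_indic01 {R : realType} (w f : nat -> R) k : (forall j, 0 <= w j) ->
  (forall N, \sum_(j < N) w j <= 1) -> (forall j, 0 <= f j <= 1) ->
  0 <= mean w k f <= 1.
Proof.
move=> w0 w1 f01; apply/andP; split.
  by apply: sumr_ge0 => j _; rewrite mulr_ge0//; case/andP: (f01 j).
apply: le_trans (w1 k); apply: ler_sum => j _.
by rewrite ler_piMr//; case/andP: (f01 j).
Qed.

(** * Chains that act along a path as a birth-death chain *)

Section path_chain.
Context {R : realType} {T : choiceType} (Z : set T) (P : T -> T -> \bar R).
Variables (K : (T -> R) -> T -> R) (s : nat -> T) (w c : nat -> R).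
Hypothesis s_inj : injective s.
Hypothesis Zs : forall j, Z (s j).
Hypothesis K_path : forall f j, K f (s j) = bd_op w c (f \o s) j.

Lemma iter_path f n j : iter n K f (s j) = iter n (bd_op w c) (f \o s) j.
Proof.
elim: n j => //= n IH j.
by rewrite K_path; congr bd_op; apply/funext => i /=.
Qed.

Lemma indic_path j : (\1_[set s j] : T -> R) \o s = delta j.
Proof.
apply/funext => i; rewrite /= indicE /delta.
have [->|ij] := eqVneq i j; first by rewrite mem_set.
by rewrite memNset// => /= /s_inj/eqP; rewrite (negbTE ij).
Qed.

Variable v : T -> \bar R.
Hypothesis P_ge0 : forall z u, Z z -> Z u -> (0 <= P z u)%E.
Hypothesis K_esum : forall f, (forall u, Z u -> 0 <= f u) ->
  forall z, Z z -> (\esum_(u in Z) (P z u * (f u)%:E) = (K f z)%:E)%E.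
Hypothesis vs : forall j, v (s j) = (w j)%:E.
Hypothesis v0 : forall z, Z z -> ~ range s z -> v z = 0%E.
Hypothesis w_gt0 : forall j, 0 < w j.
Hypothesis c0 : c 0%N = 0.
Hypothesis c_ge0 : forall j, 0 <= c j.
Hypothesis exit_le1 : forall j, c j + c j.+1 <= w j.
Hypothesis mass_le1 : forall N, \sum_(j < N) w j <= 1.

Let w_ge0 j : 0 <= w j. Proof. exact: ltW. Qed.

(** Only the events [[set s j]] are tested: along the path their indicators are the functions
    [delta j]. *)
Lemma path_chain_geometric : geometrically_ergodic Z P v ->
  exists M t, [/\ 0 < t < 1, forall n, w n.+1 <= M * t ^+ n &
  exists2 e, 0 < e & exists N, forall i, (N <= i)%N -> e <= exit_prob w c i].
Proof.
move=> /(geometrically_ergodic_dist P_ge0 K_esum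
  (weight_ge0 vs v0 w_ge0)
  (mass_path_fin_num s_inj vs v0 w_ge0 mass_le1)).
move=> [M [t [t01 H]]]; exists (M (s 0%N)), t.
have [//|wM e] := @geometric_bd_op _ w c w_gt0 c0 c_ge0 exit_le1 mass_le1
  (M \o s) t t01; last by split.
move=> i j n; have Zj : [set s j] `<=` Z by move=> _ ->.
have := H (s i) n _ (Zs i) Zj.
rewrite iter_path indic_path (mass_path (k := j.+1) s_inj vs v0 w_ge0 Zj).
  rewrite (_ : \sum_(_ < _) _ = w j)//.
  by rewrite -[RHS](@mean_delta _ w j.+1)//; apply: eq_bigr => i' _;
    rewrite -indic_path.
by move=> k jk /= /s_inj kj; move: jk; rewrite kj ltnn.
Qed.

End path_chain.

Section gibbs_chains.
Context {R : realType} (a b : nat -> R).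
Hypothesis a_gt0 : forall i, (0 < i)%N -> 0 < a i.
Hypothesis b_gt0 : forall i, (0 < i)%N -> 0 < b i.
Hypothesis b0 : b 0%N = 0.
Hypothesis ab_le1 : forall N, \sum_(j < N) (a j.+1 + b j.+1) <= 1.

Let b_ge0 := b_ge0 b_gt0 b0.
Let a1 j : 0 < a j.+1. Proof. exact: a_gt0. Qed.
Let b1 j : 0 < b j.+1. Proof. exact: b_gt0. Qed.

(* [c_harm] is half the harmonic mean, the conductance of resampling from the
   two-point set with masses [x] and [y]. *)
Definition c_harm (x y : R) := x * y / (x + y).

Lemma c_harm_ge0 x y : 0 <= x -> 0 <= y -> 0 <= c_harm x y.
Proof. by move=> x0 y0; rewrite divr_ge0 ?mulr_ge0 ?addr_ge0. Qed.

Lemma c_harmC x y : c_harm x y = c_harm y x.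
Proof. by rewrite /c_harm [y * x]mulrC [y + x]addrC. Qed.

Lemma c_harm0 x : c_harm x 0 = 0.
Proof. by rewrite /c_harm mulr0 mul0r. Qed.

Lemma c_harm_lel x y : 0 <= x -> 0 <= y -> c_harm x y <= x.
Proof.
move=> x0 y0; have [xy|xy] := eqVneq (x + y) 0.
  by rewrite /c_harm xy invr0 mulr0.
have xy0 : 0 < x + y by rewrite lt_neqAle eq_sym xy addr_ge0.
by rewrite ler_pdivrMr// ler_wpM2l// lerDr.
Qed.

Lemma c_harm_ler x y : 0 <= x -> 0 <= y -> c_harm x y <= y.
Proof. by move=> x0 y0; rewrite c_harmC c_harm_lel. Qed.

Lemma c_harm_ge x y B : 0 < x -> 0 < y -> x <= B * y -> x / (1 + B) <= c_harm x y.
Proof.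
move=> x0 y0 xy.
have B0 : 0 < B by rewrite -(pmulr_lgt0 _ y0) (lt_le_trans x0).
rewrite /c_harm ler_pdivrMr ?addr_gt0// mulrAC ler_pdivlMr ?addr_gt0//.
by rewrite -[leRHS]mulrA ler_pM2l//; lra.
Qed.

(** * The marginal chain as a birth-death chain *)

Section marginal_chain.

(** State [j] stands for [x = j.+1]. Edge [j] joins [x = j] to [x = j.+1] through [y = j], whose two
    points carry the masses [a j] and [b j]. *)
Definition w_X j := a j.+1 + b j.
Definition c_X j := c_harm (a j) (b j).

Lemma w_X_gt0 j : 0 < w_X j. Proof. by rewrite ltr_wpDr. Qed.

Lemma c_X0 : c_X 0%N = 0. Proof. by rewrite /c_X b0 c_harm0. Qed.

Lemma c_X_ge0 j : 0 <= c_X j.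
Proof. by case: j => [|j]; rewrite ?c_X0// c_harm_ge0// ltW. Qed.

Lemma c_X_le_b j : c_X j <= b j.
Proof. by case: j => [|j]; rewrite ?c_X0 ?b0// c_harm_ler// ltW. Qed.

Lemma exit_X_le1 j : c_X j + c_X j.+1 <= w_X j.
Proof. by rewrite addrC lerD ?c_X_le_b// c_harm_lel// ltW. Qed.

Lemma sum_w_X N :
  \sum_(j < N) w_X j + b N = \sum_(j < N) (a j.+1 + b j.+1).
Proof.
elim: N => [|N IH]; first by rewrite !big_ord0 b0 add0r.
by rewrite !big_ord_recr/= -IH /w_X; ring.
Qed.

Lemma mass_X_le1 N : \sum_(j < N) w_X j <= 1.
Proof. by apply: le_trans (ab_le1 N); rewrite -sum_w_X lerDl. Qed.

Lemma op_X_path f j : op_X a b f j.+1 = bd_op w_X c_X (f \o S) j.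
Proof.
have wj := w_X_gt0 j; have aj := a1 j; have bj := b1 j.
rewrite /op_X /mean_YgX /mean_XgY /pi_X /pi_Y /bd_op /w_X /c_X /c_harm /=.
rewrite /w_X in wj.
case: j wj aj bj => [|j] wj aj bj.
  rewrite b0 mul0r addr0 !mulr0 !mul0r addr0; field.
  by rewrite gt_eqF//= gt_eqF// addr_gt0.
field; rewrite gt_eqF//= gt_eqF ?addr_gt0//= gt_eqF// addr_gt0//.
Qed.

Lemma varpi_X_path j : varpi_X a b j.+1 = (w_X j)%:E. Proof. by []. Qed.

Lemma varpi_X0 z : posnat z -> ~ range S z -> varpi_X a b z = 0%E.
Proof. by case: z => // z _ []; exists z. Qed.

Lemma Phi_X_geometric : Phi_X_ge a b ->
  exists M t, [/\ 0 < t < 1, forall n, w_X n.+1 <= M * t ^+ n &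
  exists2 e, 0 < e & exists N, forall i, (N <= i)%N -> e <= exit_prob w_X c_X i].
Proof.
apply: (@path_chain_geometric _ _ _ _ (op_X a b) S) => //.
- exact: succn_inj.
- exact: op_X_path.
- exact: k_X_ge0.
- exact: op_X_esum.
- exact: varpi_X0.
- exact: w_X_gt0.
- exact: c_X0.
- exact: c_X_ge0.
- exact: exit_X_le1.
- exact: mass_X_le1.
Qed.

End marginal_chain.

(** * The deterministic scan through the marginal chain *)

Section deterministic_scan.

Definition sect (F : nat * nat -> R) x := mean_YgX a b (fun y => F (x, y)) x.

Lemma sect_iter F n : sect (iter n (op_DGS a b) F) = iter n (op_X a b) (sect F).
Proof. by elim: n => //= n <-. Qed.

(** Regrouping the half steps: [n.+1] scans draw [x] given [y], run [n] steps of the marginal chain,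
    then draw [y] given [x]. *)
Lemma iter_op_DGS F n z :
  iter n.+1 (op_DGS a b) F z = mean_XgY a b (iter n (op_X a b) (sect F)) z.2.
Proof. by rewrite /= -sect_iter. Qed.

Lemma mean_XgY_dist f y (m e : R) : (0 < y)%N ->
  `|f y - m| <= e -> `|f y.+1 - m| <= e -> `|mean_XgY a b f y - m| <= e.
Proof.
move=> y0; have ay := a_gt0 y0; have by0 := b_gt0 y0.
rewrite !ler_distl => /andP[? ?] /andP[? ?]; rewrite /mean_XgY /pi_Y.
by rewrite ler_pdivlMr ?addr_gt0// ler_pdivrMr ?addr_gt0//; apply/andP; split; nra.
Qed.

(** An average stays in the ball containing its terms. The term at [x.-1] is constrained only when
    it is a state; at [x = 1] the average is [g 1]. *)
Lemma mean_YgX_dist g x (m e : R) : (0 < x)%N ->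
  `|g x - m| <= e -> ((0 < x.-1)%N -> `|g x.-1 - m| <= e) ->
  `|mean_YgX a b g x - m| <= e.
Proof.
case: x => // -[|x] _.
  have := a1 0; rewrite /mean_YgX /pi_X /= b0 mul0r !addr0 => a10 ge _.
  by rewrite mulrAC mulfV ?gt_eqF// mul1r.
have ay := a1 x.+1; have by0 := b1 x.
move=> + /(_ isT); rewrite !ler_distl => /andP[? ?] /andP[? ?].
rewrite /mean_YgX /pi_X/=.
by rewrite ler_pdivlMr ?addr_gt0// ler_pdivrMr ?addr_gt0//; apply/andP; split; nra.
Qed.

End deterministic_scan.

(** * The staircase path carrying the joint distribution *)

Definition s_R j : nat * nat := ((uphalf j).+1, j./2.+1).
Definition w_R j := if odd j then b j./2.+1 else a j./2.+1.
Lemma half_cases (Q : nat -> Prop) :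
  (forall i, Q i.*2) -> (forall i, Q i.*2.+1) -> forall j, Q j.
Proof.
by move=> Qe Qo j; rewrite -[j]odd_double_half; case: (odd j); [exact: Qo|exact: Qe].
Qed.

Lemma s_R_even i : s_R i.*2 = (i.+1, i.+1).
Proof. by rewrite /s_R uphalf_double doubleK. Qed.
Lemma s_R_odd i : s_R i.*2.+1 = (i.+2, i.+1).
Proof. by rewrite /s_R /= doubleK uphalf_double. Qed.
Lemma w_R_even i : w_R i.*2 = a i.+1.
Proof. by rewrite /w_R odd_double doubleK. Qed.
Lemma w_R_odd i : w_R i.*2.+1 = b i.+1.
Proof. by rewrite /w_R /= odd_double/= uphalf_double. Qed.
Lemma s_R_inj : injective s_R.
Proof.
move=> i j [+ +]; rewrite -[i]odd_double_half -[j]odd_double_half => ui hi.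
by move: ui hi; rewrite !uphalf_half; lia.
Qed.

Lemma w_R_gt0 j : 0 < w_R j.
Proof.
by elim/half_cases: j => i; rewrite ?w_R_even ?w_R_odd.
Qed.

Lemma sum_path_R (f : nat -> R) N :
  \sum_(j < N.*2) w_R j * f j =
  \sum_(j < N) (a j.+1 * f j.*2 + b j.+1 * f j.*2.+1).
Proof.
elim: N => [|N IH]; first by rewrite !big_ord0.
by rewrite doubleS !big_ord_recr/= IH w_R_even w_R_odd addrA.
Qed.

Lemma mass_R_double N :
  \sum_(j < N.*2) w_R j = \sum_(j < N) (a j.+1 + b j.+1).
Proof.
have := sum_path_R (fun=> 1) N.
by under eq_bigr do rewrite mulr1; under [in RHS]eq_bigr do rewrite !mulr1.
Qed.

Lemma mass_R_le1 N : \sum_(j < N) w_R j <= 1.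
Proof.
apply: le_trans (ab_le1 N); rewrite -mass_R_double.
by apply: sum_lt_monotone => [j|]; [exact/ltW/w_R_gt0|lia].
Qed.

Lemma varpi_path j : varpi a b (s_R j) = (w_R j)%:E.
Proof.
elim/half_cases: j => i; rewrite /varpi ?s_R_even ?s_R_odd /pi_joint/= ?eqxx.
  by rewrite w_R_even.
by rewrite gtn_eqF// w_R_odd.
Qed.

Lemma varpi0 z : (posnat `*` posnat) z -> ~ range s_R z -> varpi a b z = 0%E.
Proof.
case: z => x y [/= x0 y0] sz; rewrite /varpi /pi_joint/=.
case: eqP => [xy|_].
  by exfalso; apply: sz; exists y.-1.*2; rewrite // s_R_even xy prednK.
case: eqP => [xy|//].
by exfalso; apply: sz; exists y.-1.*2.+1; rewrite // s_R_odd xy prednK.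
Qed.


(** * The random scan sampler as a birth-death chain *)

Section random_scan.
Variable p : R.
Hypothesis p01 : 0 < p < 1.

(** An odd edge joins two points with the same [y], crossed by resampling [x], hence the factor [p];
    an even edge joins two points with the same [x]. *)
Definition c_R j := if odd j then p * c_harm (a j./2.+1) (b j./2.+1)
  else (1 - p) * c_harm (a j./2.+1) (b j./2).

Let p0 : 0 < p. Proof. by case/andP: p01. Qed.
Let q0 : 0 < 1 - p. Proof. by case/andP: p01 => _; rewrite subr_gt0. Qed.

Lemma c_R_even i : c_R i.*2 = (1 - p) * c_harm (a i.+1) (b i).
Proof. by rewrite /c_R odd_double doubleK. Qed.
Lemma c_R_odd i : c_R i.*2.+1 = p * c_harm (a i.+1) (b i.+1).
Proof. by rewrite /c_R /= odd_double/= uphalf_double. Qed.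

Lemma c_R0 : c_R 0%N = 0.
Proof. by rewrite -[0%N]double0 c_R_even b0 c_harm0 mulr0. Qed.

Lemma c_R_ge0 j : 0 <= c_R j.
Proof.
by elim/half_cases: j => i; rewrite ?c_R_even ?c_R_odd;
  apply: mulr_ge0; rewrite ?(ltW p0) ?(ltW q0) ?c_harm_ge0 ?b_ge0 ?(ltW (a1 _)).
Qed.

Lemma exit_R_le1 j : c_R j + c_R j.+1 <= w_R j.
Proof.
elim/half_cases: j => i; rewrite -?doubleS ?c_R_even ?c_R_odd ?w_R_even ?w_R_odd.
- have := c_harm_lel (ltW (a1 i)) (b_ge0 i).
  have := c_harm_lel (ltW (a1 i)) (ltW (b1 i)).
  by have := p0; have := q0; nra.
- have := c_harm_ler (ltW (a1 i)) (ltW (b1 i)).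
  have := c_harm_ler (ltW (a1 i.+1)) (ltW (b1 i)).
  by have := p0; have := q0; nra.
Qed.

Lemma op_RGS_path F j : op_RGS a b p F (s_R j) = bd_op w_R c_R (F \o s_R) j.
Proof.
have aj i := a1 i; have bj i := b1 i.
rewrite /bd_op; elim/half_cases: j => i.
  rewrite [in LHS]s_R_even /op_RGS /mean_XgY /mean_YgX /pi_X /pi_Y /=.
  rewrite s_R_even s_R_odd w_R_even c_R_even c_R_odd /c_harm.
  case: i => [|i].
    rewrite b0 !mulr0 !mul0r !addr0 mulr0 mul0r addr0; field.
    by rewrite !gt_eqF ?addr_gt0.
  rewrite doubleS /= s_R_odd; field.
  by rewrite !gt_eqF ?addr_gt0.
rewrite [in LHS]s_R_odd /op_RGS /mean_XgY /mean_YgX /pi_X /pi_Y /=.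
rewrite -doubleS !s_R_even s_R_odd w_R_odd c_R_even c_R_odd /c_harm; field.
by rewrite !gt_eqF ?addr_gt0.
Qed.

Lemma Phi_RGS_geometric : Phi_RGS_ge a b p ->
  exists M t, [/\ 0 < t < 1, forall n, w_R n.+1 <= M * t ^+ n &
  exists2 e, 0 < e & exists N, forall i, (N <= i)%N -> e <= exit_prob w_R c_R i].
Proof.
apply: (@path_chain_geometric _ _ _ _ (op_RGS a b p) s_R) => //.
- exact: s_R_inj.
- exact: op_RGS_path.
- by move=> z u; exact: k_RGS_ge0.
- by move=> f f0; exact: op_RGS_esum.
- exact: varpi_path.
- exact: varpi0.
- exact: w_R_gt0.
- exact: c_R0.
- exact: c_R_ge0.
- exact: exit_R_le1.
- exact: mass_R_le1.
Qed.

End random_scan.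

(** * Stationary masses and necessity for the deterministic scan *)

Lemma mean_YgX_mul g j :
  w_X j * mean_YgX a b g j.+1 = a j.+1 * g j.+1 + b j * g j.
Proof. by rewrite /mean_YgX mulrC divfK// gt_eqF ?w_X_gt0. Qed.

(** Total expectation, conditioning on [x]. The point [(N.+1, N)] is listed on the right but its [x]
    lies beyond the truncation on the left, hence the extra term. *)
Lemma sum_sect F N :
  \sum_(j < N) w_X j * sect F j.+1 + b N * F (N.+1, N) =
  \sum_(j < N) (a j.+1 * F (j.+1, j.+1) + b j.+1 * F (j.+2, j.+1)).
Proof.
elim: N => [|N IH]; first by rewrite !big_ord0 b0 mul0r add0r.
by rewrite !big_ord_recr/= -IH mean_YgX_mul; ring.
Qed.

Lemma sect_indic_supported (A : set (nat * nat)) k :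
  (forall z, A z -> (z.1 <= k)%N) -> supported k (sect \1_A \o S).
Proof.
move=> Ak j kj; rewrite /= /sect /mean_YgX !indicE !memNset ?mulr0 ?addr0 ?mul0r//.
- by move=> /Ak/=; lia.
- by move=> /Ak/=; lia.
Qed.

Lemma mass_varpi (A : set (nat * nat)) k : A `<=` posnat `*` posnat ->
  (forall z, A z -> (z.1 <= k)%N) ->
  fine (mass (varpi a b) A) = mean w_X k (sect \1_A \o S).
Proof.
move=> AZ Ak.
rewrite (@mass_path _ _ s_R w_R _ (posnat `*` posnat) s_R_inj varpi_path
  varpi0 (fun j => ltW (w_R_gt0 j)) A k.*2 AZ); last first.
  by move=> j kj /Ak /=; rewrite uphalf_half; have := odd_double_half j; lia.
rewrite (sum_path_R (fun j => \1_A (s_R j))) /mean /=.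
under eq_bigr do rewrite s_R_even s_R_odd.
rewrite -(sum_sect \1_A) indicE memNset ?mulr0 ?addr0//.
by move=> /Ak /=; rewrite ltnn.
Qed.

Lemma varpi_fin_num : mass (varpi a b) (posnat `*` posnat) \is a fin_num.
Proof.
exact: (mass_path_fin_num s_R_inj varpi_path varpi0
  (fun j => ltW (w_R_gt0 j)) mass_R_le1).
Qed.

Lemma varpi_ge0 z : (posnat `*` posnat) z -> (0 <= varpi a b z)%E.
Proof. exact: (weight_ge0 varpi_path varpi0 (fun j => ltW (w_R_gt0 j))). Qed.

(** The events tested constrain [x] only. Averaging the error bound over [y] given [x] turns the
    scan on such events into the marginal chain. *)
Lemma Phi_DGS_geometric : Phi_DGS_ge a b ->
  exists M t, [/\ 0 < t < 1, forall n, w_X n.+1 <= M * t ^+ n &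
  exists2 e, 0 < e & exists N, forall i, (N <= i)%N -> e <= exit_prob w_X c_X i].
Proof.
move=> /(geometrically_ergodic_dist (k_DGS_ge0 a_gt0 b_gt0 b0)
  (op_DGS_esum a_gt0 b_gt0 b0) varpi_ge0 varpi_fin_num) [M [t [t01 H]]].
(* One term for each value of [y] possible given [x = i.+1]; for [i = 0] the second is just a
   harmless nonnegative number. *)
pose M' i := `|M (i.+1, i.+1)| + `|M (i.+1, i)|.
exists (M' 0%N), t.
have [//|wM e] := @geometric_bd_op _ w_X c_X w_X_gt0 c_X0 c_X_ge0 exit_X_le1
  mass_X_le1 M' t t01; last by split.
move=> i j n; pose A : set (nat * nat) := [set j.+1] `*` posnat.
have AZ : A `<=` posnat `*` posnat by move=> [z1 z2] [/= -> z20].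
have Aj : sect \1_A \o S = delta j.
  apply/funext => l; rewrite /= /sect /mean_YgX /delta !indicE /pi_X /=.
  have [->|lj] := eqVneq l j; last first.
    by rewrite !memNset ?mulr0 ?addr0 ?mul0r//= => -[/= [lj']];
      rewrite lj' eqxx in lj.
  rewrite (mem_set (u := (j.+1, j.+1)))// mulr1.
  have [j0|j0] := posnP j; first by
    rewrite (_ : b j = 0) ?mul0r ?addr0 ?divff// ?gt_eqF// j0.
  by rewrite mem_set// mulr1 divff// gt_eqF// w_X_gt0.
have mA : fine (mass (varpi a b) A) = w_X j.
  rewrite (@mass_varpi A j.+1 AZ); last by move=> [z1 z2] [/= ->].
  by rewrite Aj mean_delta.
have t0 : 0 < t by case/andP: t01.
rewrite -Aj -(@iter_path _ _ (op_X a b) S w_X c_X op_X_path).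
rewrite -sect_iter -mA; apply: mean_YgX_dist => // [|i0].
  apply: le_trans (H _ n A _ AZ) _ => //; rewrite ler_pM2r ?exprn_gt0//.
  by apply: le_trans (ler_norm _) _; rewrite lerDl.
apply: le_trans (H _ n A _ AZ) _ => //; rewrite ler_pM2r ?exprn_gt0//.
by apply: le_trans (ler_norm _) _; rewrite lerDr.
Qed.

(** * Sufficiency: ergodicity from uniform ratio and tail bounds *)

Section sufficiency.
Variables (B C : R) (V : nat -> R).
Hypothesis a_le : forall i, a i.+1 <= B * b i.+1.
Hypothesis a_le' : forall i, a i.+2 <= B * b i.+1.
Hypothesis C_gt0 : 0 < C.
Hypothesis V_ge0 : forall i, 0 <= V i.
Hypothesis V_decr : forall i, a i.+1 + b i.+1 <= V i - V i.+1.
Hypothesis V_le : forall i, V i <= C * a i.+1.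
Hypothesis ab_cvg : forall e, 0 < e ->
  exists N, 1 - e <= \sum_(j < N) (a j.+1 + b j.+1).

Let B_gt0 : 0 < B.
Proof. by rewrite -(pmulr_lgt0 _ (b1 0)) (lt_le_trans (a1 0)). Qed.

(** With [V j] in the role of the mass of all pairs after the [j]-th, the tail of [w_X] from state
    [j] is [V j + b j], since [w_X j] pairs [a j.+1] with the earlier [b j]. *)
Lemma op_X_geometric : exists t, 0 < t < 1 /\
  forall k f n i, supported k (f \o S) -> (forall j, 0 <= f j.+1 <= 1) ->
  `|iter n (op_X a b) f i.+1 - mean w_X k (f \o S)| <= t ^+ n / Num.sqrt (w_X i).
Proof.
have B1 : 0 < 1 + B by rewrite addr_gt0.
have VX j : V j.+1 + b j.+1 <= C * (1 + B) * c_X j.+1.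
  apply: (@le_trans _ _ (C * a j.+1)).
    by have := V_decr j; have := V_le j; have := a1 j; lra.
  rewrite -mulrA ler_pM2l// mulrC -ler_pdivrMr//.
  exact: c_harm_ge.
have massX e : 0 < e -> exists N, 1 - e <= \sum_(j < N) w_X j.
  move=> /ab_cvg[N Ne]; exists N.+1; apply: (le_trans Ne).
  by rewrite -sum_w_X big_ord_recr/= lerD2l /w_X lerDr ltW.
(* Only the second state has to hold: from [x = j.+2], draw [y = j.+1] and then [x] again. Both
   draws have probability at least [(1 + B)^-1]. *)
have exitX j : exit_prob w_X c_X j + exit_prob w_X c_X j.+1 <=
    2 - (1 + B) ^- 2.
  have := exit_X_le1 j; rewrite -[X in _ <= X -> _]mul1r -ler_pdivrMr ?w_X_gt0//.
  rewrite -/(exit_prob w_X c_X j) => e1.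
  suff : exit_prob w_X c_X j.+1 <= 1 - (1 + B) ^- 2 by lra.
  rewrite ler_pdivrMr ?w_X_gt0// mulrBl mul1r.
  have -> : c_X j.+1 = b j.+1 - b j.+1 ^+ 2 / (a j.+1 + b j.+1).
    by rewrite /c_X /c_harm; field; rewrite gt_eqF ?addr_gt0.
  have := c_harm_lel (ltW (a1 j.+1)) (ltW (b1 j.+1)); rewrite -/(c_X j.+2).
  have : (1 + B) ^- 2 * w_X j.+1 <= b j.+1 ^+ 2 / (a j.+1 + b j.+1).
    rewrite mulrC ler_pdivrMr ?exprn_gt0// mulrAC ler_pdivlMr ?addr_gt0//.
    rewrite expr2 [leRHS](_ : _ = ((1 + B) * b j.+1) * ((1 + B) * b j.+1)); last by ring.
    rewrite /w_X; apply: ler_pM; rewrite ?addr_ge0 ?(ltW (a1 _)) ?(ltW (b1 _))//.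
      by have := a_le' j; lra.
    by have := a_le j; lra.
  by rewrite /w_X; lra.
have [| | | |//|//|//|t [t01 H]] := @bd_op_geometric _ w_X c_X w_X_gt0 c_X0 c_X_ge0
  exit_X_le1 mass_X_le1 (fun j => V j + b j) (C * (1 + B)) ((1 + B) ^- 2).
- by rewrite mulr_gt0.
- by rewrite invr_gt0 exprn_gt0.
- by move=> j; rewrite addr_ge0.
- by move=> j; have := V_decr j; rewrite /w_X; lra.
exists t; split=> // k f n i kf f01.
by rewrite (@iter_path _ _ (op_X a b) S w_X c_X op_X_path); exact: H.
Qed.

Lemma Phi_X_ge_of_bounds : Phi_X_ge a b.
Proof.
have [t [t01 H]] := op_X_geometric.
apply: (geometrically_ergodic_finite (k_X_ge0 a_gt0 b_gt0 b0)
  (op_X_esum a_gt0 b_gt0 b0)).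
- exact: (weight_ge0 varpi_X_path varpi_X0 (fun j => ltW (w_X_gt0 j))).
- exact: (mass_path_fin_num succn_inj varpi_X_path varpi_X0
    (fun j => ltW (w_X_gt0 j)) mass_X_le1).
exists (fun z => (Num.sqrt (w_X z.-1))^-1), t; split=> // -[//|z] n F _ finF FZ.
have [k Fk] := finite_path_bounded succn_inj finF.
rewrite (mass_path succn_inj varpi_X_path varpi_X0 (fun j => ltW (w_X_gt0 j)) FZ Fk).
rewrite mulrC; apply: H => [j kj|j]; last exact: indic01.
by rewrite /= indicE memNset//; exact: Fk.
Qed.

Lemma sect_indic01 (A : set (nat * nat)) j : 0 <= sect \1_A j.+1 <= 1.
Proof.
(* Seen as a ball around 1/2, the interval falls under [mean_YgX_dist]. *)
have H (y : R) : (0 <= y <= 1) = (`|y - 2^-1| <= 2^-1).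
  by rewrite ler_distl; apply/idP/idP => /andP[? ?]; apply/andP; split; lra.
by rewrite H//; apply: mean_YgX_dist => // *; rewrite -H// indic01.
Qed.

Lemma indic_dist_le1 (A : set (nat * nat)) z k :
  `|\1_A z - mean w_X k (sect \1_A \o S)| <= 1.
Proof.
have /andP[m0 m1] := @mean_indic01 _ w_X (sect \1_A \o S) k (fun j => ltW (w_X_gt0 j))
  mass_X_le1 (sect_indic01 A).
by have /andP[? ?] := @indic01 R _ A z; rewrite ler_distl; apply/andP; split; lra.
Qed.

Lemma finite_fst_bounded (F : set (nat * nat)) : finite_set F ->
  exists k, forall z, F z -> (z.1 <= k)%N.
Proof.
move=> finF; have [k Fk] := finite_path_bounded succn_inj (finite_image fst finF).
exists k => -[[//|x] y] Fz; rewrite leqNgt; apply/negP => /= kx.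
by apply: (Fk x) => //; exists (x.+1, y).
Qed.

Lemma Phi_DGS_ge_of_bounds : Phi_DGS_ge a b.
Proof.
have [t [t01 H]] := op_X_geometric; have /andP[t0 t1] := t01.
apply: (geometrically_ergodic_finite (k_DGS_ge0 a_gt0 b_gt0 b0)
  (op_DGS_esum a_gt0 b_gt0 b0) varpi_ge0 varpi_fin_num).
pose D x := (Num.sqrt (w_X x))^-1.
have D0 x : 0 <= D x by rewrite invr_ge0 sqrtr_ge0.
(* The 1 covers [n = 0], and the division by [t] pays for [n.+1] scans containing only [n] marginal
   steps. The two terms serve the first draws [x = y] and [x = y.+1], so starting points of mass
   zero are covered too. *)
exists (fun z => 1 + (D z.2.-1 + D z.2) / t), t; split=> // -[x y] n F [/= x0 y0] finF FZ.
have [k Fk] := finite_fst_bounded finF; rewrite (mass_varpi FZ Fk).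
case: n => [|n].
  rewrite expr0 mulr1 /=; apply: (le_trans (indic_dist_le1 _ _ _)).
  by rewrite lerDl divr_ge0 ?addr_ge0 ?(ltW t0).
rewrite iter_op_DGS /= exprS mulrA mulrDl divfK ?gt_eqF// mul1r.
have sk := sect_indic_supported Fk.
have tn : 0 <= t ^+ n by rewrite exprn_ge0 ?ltW.
apply: mean_XgY_dist => //.
- case: y y0 => // y _; apply: le_trans (H _ _ n y sk (sect_indic01 F)) _.
  by rewrite mulrC ler_wpM2r//= -/(D y); have := D0 y; have := D0 y.+1; lra.
- apply: le_trans (H _ _ n y sk (sect_indic01 F)) _.
  by rewrite mulrC ler_wpM2r// -/(D y); have := D0 y; have := D0 y.-1; lra.
Qed.

Section random_scan_sufficiency.
Variable p : R.
Hypothesis p01 : 0 < p < 1.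
Let p0 : 0 < p. Proof. by case/andP: p01. Qed.
Let q0 : 0 < 1 - p. Proof. by case/andP: p01 => _; rewrite subr_gt0. Qed.

Lemma op_RGS_geometric : exists t, 0 < t < 1 /\
  forall k F n i, supported k (F \o s_R) -> (forall z, 0 <= F z <= 1) ->
  `|iter n (op_RGS a b p) F (s_R i) - mean w_R k (F \o s_R)| <=
  t ^+ n / Num.sqrt (w_R i).
Proof.
have B1 : 0 < 1 + B by rewrite addr_gt0.
have pq : 0 < p * (1 - p) by rewrite mulr_gt0.
(* The tail from position [j] of the staircase: at an odd position the [a] of the current pair is
   already behind. *)
pose VR j := if odd j then V j./2.+1 + b j./2.+1 else V j./2.
have VRe i : VR i.*2 = V i by rewrite /VR odd_double doubleK.
have VRo i : VR i.*2.+1 = V i.+1 + b i.+1.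
  by rewrite /VR /= odd_double/= uphalf_double.
have a_c x y : 0 < x -> 0 < y -> x <= B * y -> x <= (1 + B) * c_harm x y.
  by move=> x0 y0 xy; rewrite mulrC -ler_pdivrMr// c_harm_ge.
have CB : 0 < C * (1 + B) by rewrite mulr_gt0.
have VRc j : VR j.+1 <= C * (1 + B) / (p * (1 - p)) * c_R p j.+1.
  elim/half_cases: j => i; rewrite -?doubleS ?VRe ?VRo ?c_R_even ?c_R_odd.
    have -> : C * (1 + B) / (p * (1 - p)) * (p * c_harm (a i.+1) (b i.+1)) =
        C * ((1 + B) * c_harm (a i.+1) (b i.+1)) / (1 - p).
      by field; rewrite !gt_eqF.
    rewrite ler_pdivlMr//.
    apply: (@le_trans _ _ (V i.+1 + b i.+1)).
      by rewrite ler_piMr ?addr_ge0//; have := p0; lra.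
    apply: (@le_trans _ _ (C * a i.+1)).
      by have := V_decr i; have := V_le i; have := a1 i; lra.
    by rewrite ler_pM2l// a_c.
  have -> : C * (1 + B) / (p * (1 - p)) * ((1 - p) * c_harm (a i.+2) (b i.+1)) =
      C * ((1 + B) * c_harm (a i.+2) (b i.+1)) / p.
    by field; rewrite !gt_eqF.
  rewrite ler_pdivlMr//; apply: (@le_trans _ _ (V i.+1)).
    by rewrite ler_piMr//; have := q0; lra.
  apply: (le_trans (V_le _)).
  by rewrite ler_pM2l// a_c.
have massR e : 0 < e -> exists N, 1 - e <= \sum_(j < N) w_R j.
  by move=> /ab_cvg[N Ne]; exists N.*2; rewrite mass_R_double.
have half_harm x y : 0 < x -> 0 < y -> c_harm x y / x + c_harm x y / y = 1.
  by move=> x0 y0; rewrite /c_harm; field; rewrite !gt_eqF ?addr_gt0.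
have harm_x x y : 0 < x -> 0 <= y -> c_harm x y / x <= 1.
  by move=> x0 y0; rewrite ler_pdivrMr// mul1r c_harm_lel// ltW.
have harm_y x y : 0 <= x -> 0 < y -> c_harm x y / y <= 1.
  by move=> x0 y0; rewrite ler_pdivrMr// mul1r c_harm_ler// ltW.
(* By [half_harm] the shared edge contributes only once its selection probability, not twice. The
   exits thus sum to at most [2 - p] or [2 - (1 - p)], and [p * (1 - p)] is below both [p] and
   [1 - p]. *)
have exitR j : exit_prob w_R (c_R p) j + exit_prob w_R (c_R p) j.+1 <=
    2 - p * (1 - p).
  have E (u v x y z : R) : (u * x + v * y) / z = u * (x / z) + v * (y / z).
    by rewrite mulrDl !mulrA.
  have K (u v x y : R) : u <= 1 -> v <= 1 -> x + y = 1 ->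
      (1 - p) * u + p * x + (p * y + (1 - p) * v) <= 2 - p * (1 - p).
    by have := p0; have := q0; nra.
  have K' (u v x y : R) : u <= 1 -> v <= 1 -> x + y = 1 ->
      p * u + (1 - p) * y + ((1 - p) * x + p * v) <= 2 - p * (1 - p).
    by have := p0; have := q0; nra.
  elim/half_cases: j => i; rewrite /exit_prob -?doubleS ?w_R_even ?w_R_odd
    ?c_R_even ?c_R_odd !E.
    exact: K (harm_x _ _ _ _) (harm_y _ _ (ltW _) _) (half_harm _ _ _ _).
  exact: K' (harm_y _ _ (ltW _) _) (harm_x _ _ _ (ltW _)) (half_harm _ _ _ _).
have [| | | |//|//|//|t [t01 H]] := @bd_op_geometric _ w_R (c_R p) w_R_gt0
  (c_R0 p) (c_R_ge0 p01) (exit_R_le1 p01) mass_R_le1 VR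
  (C * (1 + B) / (p * (1 - p))) (p * (1 - p)).
- by rewrite divr_gt0.
- by [].
- by elim/half_cases => i; rewrite ?VRe ?VRo ?addr_ge0.
- elim/half_cases => i; rewrite -?doubleS ?VRe ?VRo ?w_R_even ?w_R_odd.
    by have := V_decr i; lra.
  by lra.
exists t; split=> // k F n i kF F01.
rewrite (@iter_path _ _ (op_RGS a b p) s_R w_R (c_R p) (op_RGS_path p)).
by apply: H => // j; exact: F01.
Qed.

Lemma Phi_RGS_ge_of_bounds : Phi_RGS_ge a b p.
Proof.
have [t [t01 H]] := op_RGS_geometric; have /andP[t0 t1] := t01.
apply: (geometrically_ergodic_finite
  (fun z z' => k_RGS_ge0 a_gt0 b_gt0 b0 p01)
  (fun f f0 => op_RGS_esum a_gt0 b_gt0 b0 p01 f0) varpi_ge0 varpi_fin_num).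
pose D i := (Num.sqrt (w_R i))^-1.
have D0 x : 0 <= D x by rewrite invr_ge0 sqrtr_ge0.
(* A starting point off the staircase is on it after one update that resamples [x] given [y] or [y]
   given [x]. [E] gathers the constants of the possible landing points, with [x] shifted by one, and
   the division by [t] pays for that update. *)
pose E x := D x.*2 + D x.*2.+1 + D x.-1.*2.+1.
have E0 x : 0 <= E x by rewrite !addr_ge0.
exists (fun z => 1 + (E z.1.-1 + E z.2.-1) / t), t; split=> // -[x y] n F [/= x0 y0] finF FZ.
have [k Fk] := finite_path_bounded s_R_inj finF.
rewrite (mass_path s_R_inj varpi_path varpi0 (fun j => ltW (w_R_gt0 j)) FZ Fk).
rewrite -[\sum_(_ < _) _]/(mean w_R k (\1_F \o s_R)).
have /andP[m0 m1] := @mean_indic01 _ w_R (\1_F \o s_R) k (fun j => ltW (w_R_gt0 j))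
  mass_R_le1 (fun j => indic01 F _).
have kF : supported k (\1_F \o s_R : nat -> R).
  by move=> j /Fk Fj; rewrite /= indicE memNset.
case: n => [|n].
  rewrite expr0 mulr1 /=; apply: (@le_trans _ _ 1); last first.
    by rewrite lerDl divr_ge0 ?addr_ge0 ?(ltW t0).
  by have /andP[? ?] := @indic01 R _ F (x, y); rewrite ler_distl; apply/andP; split; lra.
rewrite /= exprS mulrA mulrDl divfK ?gt_eqF// mul1r.
set m := mean _ _ _ in m0 m1 *; set G := iter n _ _.
have tn : 0 <= t ^+ n by rewrite exprn_ge0 ?ltW.
have HG i e : D i <= e -> `|G (s_R i) - m| <= e * t ^+ n.
  move=> ie; apply: le_trans (H k \1_F n i kF (indic01 F)) _.
  by rewrite mulrC ler_wpM2r.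
case: x x0 {FZ} => // x _; case: y y0 => // y _ /=.
have := D0 x.*2; have := D0 x.*2.+1; have := D0 x.-1.*2.+1.
have := D0 y.*2; have := D0 y.*2.+1; have := D0 y.-1.*2.+1 => d1 d2 d3 d4 d5 d6.
set e := (_ + _) * _.
have : `|mean_XgY a b (fun x' => G (x', y.+1)) y.+1 - m| <= e.
  apply: mean_XgY_dist => //.
    by rewrite -s_R_even; apply: HG; rewrite /E; lra.
  by rewrite -s_R_odd; apply: HG; rewrite /E; lra.
have : `|mean_YgX a b (fun y' => G (x.+1, y')) x.+1 - m| <= e.
  apply: mean_YgX_dist => //=.
    by rewrite -s_R_even; apply: HG; rewrite /E; lra.
  case: (x) @e d4 d5 d6 => // x' e d4 d5 d6 _ /=.
  by rewrite -s_R_odd; apply: HG; rewrite /E/=; lra.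
rewrite /op_RGS /= !ler_distl => /andP[? ?] /andP[? ?].
by apply/andP; split; have := p0; have := q0; nra.
Qed.

End random_scan_sufficiency.
End sufficiency.
End gibbs_chains.

(** * Limits of ratios *)

Lemma cvg_shift2 {V : ptopologicalType} (u : nat -> V) (l : set_system V) :
  (fun i => u i.+2) @ \oo --> l -> u @ \oo --> l.
Proof.
by move=> ul; rewrite -(cvg_shiftS u) -(cvg_shiftS (fun i => u i.+1)).
Qed.

Lemma cvgn_bounded {R : realType} (u : nat -> R) (l : R) :
  u @ \oo --> l -> exists2 B, 0 < B & forall i, u i <= B.
Proof.
move=> ul; have /cvg_seq_bounded/pinfty_ex_gt0[B B0 uB] : cvgn u by apply/cvg_ex; exists l.
exists B => // i; exact: le_trans (ler_norm _) (uB i I).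
Qed.

Section ratio_limits.
Context {R : realType} (a b : nat -> R) (A L : R).
Hypothesis a_gt0 : forall i, (0 < i)%N -> 0 < a i.
Hypothesis b_gt0 : forall i, (0 < i)%N -> 0 < b i.
Hypothesis cvg_aa : (fun i => a i.+2 / a i.+1) @ \oo --> A.
Hypothesis cvg_ab : (fun i => a i.+1 / b i.+1) @ \oo --> L.

Let a1 j : 0 < a j.+1. Proof. exact: a_gt0. Qed.
Let b1 j : 0 < b j.+1. Proof. exact: b_gt0. Qed.

Lemma ratio_lim_ge0 : 0 <= A /\ 0 <= L.
Proof.
split; [apply: (cvgr_to_ge cvg_aa)|apply: (cvgr_to_ge cvg_ab)].
- by apply: nearW => i; rewrite divr_ge0// ltW.
- by apply: nearW => i; rewrite divr_ge0// ltW.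
Qed.

Lemma cvg_aab : (fun i => a i.+2 / b i.+1) @ \oo --> A * L.
Proof.
have -> : (fun i => a i.+2 / b i.+1) =
    (fun i => a i.+2 / a i.+1 * (a i.+1 / b i.+1)).
  by apply/funext => i; rewrite mulrA divfK// gt_eqF.
exact: cvgM.
Qed.

Lemma cvg_a_b1 : (fun i => a i / b i.-1) @ \oo --> A * L.
Proof. by apply: cvg_shift2; exact: cvg_aab. Qed.

Lemma cvg_b_a : 0 < L -> (fun i => b i / a i) @ \oo --> L^-1.
Proof.
move=> L0; rewrite -cvg_shiftS.
have -> : [sequence b i.+1 / a i.+1]_i = (fun i => (a i.+1 / b i.+1)^-1).
  by apply/funext => i /=; rewrite invf_div.
by apply: cvgV => //; rewrite gt_eqF.
Qed.

Lemma cvg_b_a_pinfty : L = 0 -> (fun i => b i / a i) @ \oo --> +oo.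
Proof.
move=> L0; rewrite -cvg_shiftS.
have -> : [sequence b i.+1 / a i.+1]_i = (fun i => (a i.+1 / b i.+1)^-1).
  by apply/funext => i /=; rewrite invf_div.
apply/cvgrVy; last by rewrite -L0.
by apply: nearW => i; rewrite divr_gt0.
Qed.

(** The quotient is the ratio of successive [a] times [(1 + a i.-1 / b i.-1) / (1 + a i / b i)], and
    this factor tends to 1. *)
Lemma cvg_up_down : (fun i => p_up a b i / q_down a b i) @ \oo --> A.
Proof.
apply: cvg_shift2; have [_ L0] := ratio_lim_ge0.
have -> : (fun i => p_up a b i.+2 / q_down a b i.+2) =
    (fun i => a i.+2 / a i.+1 * ((1 + a i.+1 / b i.+1) / (1 + a i.+2 / b i.+2))).
  apply/funext => i; rewrite /p_up /q_down /=; field.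
  by rewrite !gt_eqF ?addr_gt0.
have L1 : 1 + L != 0 by rewrite gt_eqF// ltr_wpDr.
suff : (fun i => a i.+2 / a i.+1 *
    ((1 + a i.+1 / b i.+1) / (1 + a i.+2 / b i.+2))) @ \oo -->
    A * ((1 + L) / (1 + L)) by rewrite divff// mulr1.
apply: cvgM => //; apply: cvgM.
  by apply: cvgD => //; exact: cvg_cst.
apply: cvgV => //; apply: cvgD; first exact: cvg_cst.
by rewrite (cvg_shiftS (fun i => a i.+1 / b i.+1)).
Qed.

Lemma cvg_down : q_down a b @ \oo --> L / ((A * L + 1) * (L + 1)).
Proof.
apply: cvg_shift2; have [A0 L0] := ratio_lim_ge0.
have -> : (fun i => q_down a b i.+2) = (fun i => a i.+1 / b i.+1 /
    ((a i.+2 / b i.+1 + 1) * (a i.+1 / b i.+1 + 1))).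
  apply/funext => i; rewrite /q_down /=; field.
  by rewrite !gt_eqF ?addr_gt0.
apply: cvgM => //; apply: cvgV.
  by rewrite mulf_neq0// gt_eqF// ltr_wpDl ?mulr_ge0.
by apply: cvgM; apply: cvgD => //; [exact: cvg_aab|exact: cvg_cst|exact: cvg_cst].
Qed.

(** In the limit the exit bound reads [e <= L + A * L], excluding [L = 0]. If [A >= 1], then [a]
    would eventually decay no faster than [r ^+ n] with [t < r < 1]. *)
Lemma ratio_lim_of_geometric M t e N : 0 < t < 1 ->
  (forall n, a n.+2 <= M * t ^+ n) -> 0 < e ->
  (forall i, (N <= i)%N -> e <= a i.+1 / b i.+1 + a i.+2 / b i.+1) ->
  0 < L /\ A < 1.
Proof.
move=> /andP[t0 t1] aM e0 eN; have [A0 L0] := ratio_lim_ge0; split.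
  have : e <= L + A * L.
    apply: (cvgr_to_ge (cvgD cvg_ab cvg_aab)).
    by exists N => // i /=; exact: eN.
  have : 0 <= A * L by rewrite mulr_ge0.
  by rewrite lt_neqAle L0 andbT => _ eL; apply/eqP => L00; move: eL; rewrite -L00; lra.
rewrite ltNge; apply/negP => A1.
pose r := (1 + t) / 2; have r0 : 0 < r by rewrite divr_gt0//; lra.
have tr : 0 <= t / r < 1.
  by rewrite divr_ge0 ?ltW//= ltr_pdivrMr// mul1r /r; lra.
have [|K _ Kr] := cvgr_gt _ cvg_aa r; first by rewrite /r; lra.
have aK n : a K.+2 * r ^+ n <= a (K + n).+2.
  elim: n => [|n IH]; first by rewrite addn0 mulr1.
  have := Kr (K + n.+1)%N (leq_addr _ _); rewrite ltr_pdivlMr// => /ltW.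
  rewrite addnS; apply: le_trans.
  by rewrite exprS mulrCA ler_pM2l.
have [n /(_ n (leqnn _))] := geometric_lt (M * t ^+ K) tr (a1 K.+1).
rewrite expr_div_n mulrA ltr_pdivrMr ?exprn_gt0// ltNge -mulrA -exprD.
by rewrite (le_trans (aK n)).
Qed.

(** From some [K] on, [a] decreases at least as fast as a geometric sequence of ratio [r < 1]. [S]
    is the exact sum up to [K] followed by the geometric majorant, which avoids infinite sums. *)
Lemma tail_bound : A < 1 -> exists (S : nat -> R) (C : R),
  [/\ 0 < C, forall i, 0 <= S i, forall i, a i.+1 <= S i - S i.+1 &
  forall i, S i <= C * a i.+1].
Proof.
move=> A1; have [A0 _] := ratio_lim_ge0.
pose r := (1 + A) / 2; have r1 : 0 < 1 - r by rewrite /r; lra.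
have [|K _ Kr] := cvgr_lt _ cvg_aa r; first by rewrite /r; lra.
have {}Kr i : (K <= i)%N -> a i.+2 <= r * a i.+1.
  by move=> /Kr /=; rewrite ltr_pdivrMr// => /ltW.
pose S i := \sum_(i <= k < K) a k.+1 + a (maxn i K).+1 / (1 - r).
have S0 i : 0 <= S i.
  by rewrite addr_ge0 ?divr_ge0 ?(ltW r1) ?(ltW (a1 _))// sumr_ge0// => k _; exact: ltW.
(* The first term of the constant serves the indices from [K] on, the sum serves the finitely many
   earlier ones. *)
exists S, ((1 - r)^-1 + \sum_(k < K) S k / a k.+1); split=> //.
- rewrite ltr_wpDr ?invr_gt0// sumr_ge0// => k _.
  by rewrite divr_ge0 ?(ltW (a1 _)).
- move=> i; rewrite /S; have [iK|Ki] := ltnP i K.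
    rewrite (maxn_idPr iK) big_ltn//.
    by set X := \sum_(_ <= _ < _) _; lra.
  rewrite !big_geq ?(leqW Ki)// !add0r (maxn_idPl (leqW Ki)).
  rewrite -mulrBl ler_pdivlMr// mulrBr mulr1 lerB// mulrC.
  exact: Kr.
- move=> i; rewrite mulrDl; have [iK|Ki] := ltnP i K.
    rewrite ler_wpDl ?mulr_ge0 ?invr_ge0 ?(ltW r1) ?(ltW (a1 _))//.
    rewrite -ler_pdivrMr// (bigD1 (Ordinal iK))//= lerDl sumr_ge0// => k _.
    by rewrite divr_ge0 ?(ltW (a1 _)).
  rewrite {1}/S big_geq// add0r (maxn_idPl Ki) mulrC lerDl.
  rewrite mulr_ge0 ?(ltW (a1 _))// sumr_ge0// => k _.
  by rewrite divr_ge0 ?(ltW (a1 _)).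
Qed.

Lemma bounds_of_ratio_lim : 0 < L -> A < 1 -> exists (B C : R) (V : nat -> R),
  [/\ (forall i, a i.+1 <= B * b i.+1) /\ (forall i, a i.+2 <= B * b i.+1),
      0 < C, forall i, 0 <= V i,
      forall i, a i.+1 + b i.+1 <= V i - V i.+1 &
      forall i, V i <= C * a i.+1].
Proof.
move=> L0 A1; have [B1 B10 H1] := cvgn_bounded cvg_ab.
have [B2 B20 H2] := cvgn_bounded cvg_aab.
have [B3 B30 H3] := cvgn_bounded (cvg_b_a L0).
have [S [C [C0 S0 Sa SC]]] := tail_bound A1.
exists (B1 + B2), ((1 + B3) * C), (fun i => (1 + B3) * S i).
have B31 : 0 < 1 + B3 by rewrite addr_gt0.
split=> [|||i|i].
- split=> i; rewrite -ler_pdivrMr//.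
    by apply: le_trans (H1 i) _; rewrite lerDl ltW.
  by apply: le_trans (H2 i) _; rewrite lerDr ltW.
- by rewrite mulr_gt0.
- by move=> i; rewrite mulr_ge0// ltW.
- apply: (@le_trans _ _ ((1 + B3) * a i.+1)); last by rewrite -mulrBr ler_pM2l.
  by rewrite mulrDl mul1r lerD2l -ler_pdivrMr.
- by rewrite -mulrA ler_pM2l.
Qed.

End ratio_limits.

(** * Total mass one, through finite partial sums *)

Section total_mass.
Context {R : realType} (a b : nat -> R).
Hypothesis a_gt0 : forall i, (0 < i)%N -> 0 < a i.
Hypothesis b_gt0 : forall i, (0 < i)%N -> 0 < b i.
Hypothesis sum1 :
  (\sum_(1 <= i <oo) (a i)%:E + \sum_(1 <= i <oo) (b i)%:E = 1)%E.

Let cvg_sum : (fun N => \sum_(1 <= i < N) (a i + b i)%:E)%E @ \oo --> 1%:E.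
Proof.
rewrite -sum1 -nneseriesD; last 2 first.
- by move=> i i0 _; rewrite lee_fin ltW// a_gt0.
- by move=> i i0 _; rewrite lee_fin ltW// b_gt0.
under [X in _ --> X]eq_eseriesr do rewrite -EFinD.
apply: is_cvg_nneseries => i i0 _.
by rewrite lee_fin addr_ge0// ltW ?a_gt0 ?b_gt0.
Qed.

Let sumE N : (\sum_(1 <= i < N.+1) (a i + b i)%:E)%E =
  (\sum_(j < N) (a j.+1 + b j.+1))%:E.
Proof. by rewrite sumEFin big_add1 big_mkord. Qed.

Lemma sum_ab_le1 N : \sum_(j < N) (a j.+1 + b j.+1) <= 1.
Proof.
rewrite -lee_fin -sumE -(cvg_lim _ cvg_sum)//.
apply: (@nneseries_lim_ge _ (fun i => (a i + b i)%:E) xpredT) => i i0 _.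
by rewrite lee_fin addr_ge0// ltW ?a_gt0 ?b_gt0.
Qed.

Lemma sum_ab_cvg e : 0 < e ->
  exists N, 1 - e <= \sum_(j < N) (a j.+1 + b j.+1).
Proof.
move=> e0; have := cvg_sum; rewrite -cvg_shiftS.
under [X in X @ _ --> _ -> _]funext => N do rewrite /= sumE.
move=> /fine_cvgP[_] /cvgr_ge /(_ (1 - e)) /=.
rewrite gtrBl => /(_ e0)[N _ NP]; exists N; exact: (NP N (leqnn _)).
Qed.

End total_mass.

(** * Necessary conditions expressed by the two sequences *)

Section necessity.
Context {R : realType} (a b : nat -> R).
Hypothesis a_gt0 : forall i, (0 < i)%N -> 0 < a i.
Hypothesis b_gt0 : forall i, (0 < i)%N -> 0 < b i.
Hypothesis b0 : b 0%N = 0.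
Hypothesis ab_le1 : forall N, \sum_(j < N) (a j.+1 + b j.+1) <= 1.

Let b_ge0 := b_ge0 b_gt0 b0.
Let a1 j : 0 < a j.+1. Proof. exact: a_gt0. Qed.
Let b1 j : 0 < b j.+1. Proof. exact: b_gt0. Qed.

(** The common consequence of the three kinds of ergodicity. The sum of ratios dominates the
    probability of leaving the state that carries [b i.+1], each conductance there being at most the
    adjacent [a]. *)
Definition geometric_tail_and_exit := exists M t e N,
  [/\ 0 < t < 1, forall n, a n.+2 <= M * t ^+ n, 0 < e &
  forall i, (N <= i)%N -> e <= a i.+1 / b i.+1 + a i.+2 / b i.+1].

Lemma X_geometric_tail_and_exit :
  (exists M t, [/\ 0 < t < 1, forall n, w_X a b n.+1 <= M * t ^+ n &
    exists2 e, 0 < e & exists N, forall i, (N <= i)%N ->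
      e <= exit_prob (w_X a b) (c_X a b) i]) -> geometric_tail_and_exit.
Proof.
move=> [M [t [t01 wM [e e0 [N eN]]]]]; exists M, t, e, N; split=> //.
- by move=> n; apply: le_trans (wM n); rewrite lerDl.
- move=> i Ni; apply: le_trans (eN i.+1 (leqW Ni)) _; rewrite /exit_prob -mulrDl.
  apply: ler_pM.
  + by rewrite addr_ge0// c_harm_ge0// ltW.
  + by rewrite invr_ge0 addr_ge0// ltW.
  + by rewrite lerD// c_harm_lel// ltW.
  + by rewrite lef_pV2 ?posrE ?addr_gt0// lerDr ltW.
Qed.

Lemma R_geometric_tail_and_exit p : 0 < p < 1 ->
  (exists M t, [/\ 0 < t < 1, forall n, w_R a b n.+1 <= M * t ^+ n &
    exists2 e, 0 < e & exists N, forall i, (N <= i)%N ->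
      e <= exit_prob (w_R a b) (c_R a b p) i]) -> geometric_tail_and_exit.
Proof.
move=> /andP[p0 p1] [M [t [/andP[t0 t1] wM [e e0 [N eN]]]]].
exists M, t, e, N; split=> //; first by rewrite t0.
- move=> n; have := wM n.*2.+1; rewrite -doubleS w_R_even => /le_trans; apply.
  (* Position [n.+1.*2] carries [a n.+2], with exponent [2n + 1]; lowering it to [n] requires
     [M >= 0]. *)
  have M0 : 0 <= M.
    by have := wM 0%N; rewrite expr0 mulr1; apply: le_trans; exact: (ltW (w_R_gt0 a_gt0 b_gt0 _)).
  by rewrite ler_wpM2l// ler_wiXn2l ?ltW//; lia.
- move=> i Ni; have Ni' : (N <= i.*2.+1)%N by lia.
  apply: le_trans (eN _ Ni') _.
  rewrite /exit_prob -doubleS c_R_odd c_R_even w_R_odd -mulrDl ler_pM2r ?invr_gt0//.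
  have := c_harm_lel (ltW (a1 i)) (ltW (b1 i)).
  have := c_harm_lel (ltW (a1 i.+1)) (ltW (b1 i)).
  have := c_harm_ge0 (ltW (a1 i)) (ltW (b1 i)).
  have := c_harm_ge0 (ltW (a1 i.+1)) (ltW (b1 i)).
  by have := a1 i; have := a1 i.+1; nra.
Qed.

End necessity.

Theorem corollary2 (R : realType) (a b : nat -> R) (p : R)
  (a_gt0 : forall i, (0 < i)%N -> 0 < a i)
  (b_gt0 : forall i, (0 < i)%N -> 0 < b i)
  (sum1 : (\sum_(1 <= i <oo) (a i)%:E + \sum_(1 <= i <oo) (b i)%:E = 1)%E)
  (b0 : b 0%N = 0)
  (p01 : 0 < p < 1)
  (cvgA : cvgn (fun i => a i / a i.-1))
  (cvgL : cvgn (fun i => a i / b i)) :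
  [/\ cvgn (fun i => (a i / b i.-1)%:E),
      cvgn (fun i => (b i / a i)%:E),
      cvgn (fun i => p_up a b i / q_down a b i)
    & cvgn (fun i => q_down a b i)] /\
  [<-> [/\ (limn (fun i => (a i / b i.-1)%:E) < +oo)%E,
           (limn (fun i => (b i / a i)%:E) < +oo)%E
         & limn (fun i => a i / a i.-1) < 1];
       limn (fun i => p_up a b i / q_down a b i) < 1 /\
         0 < limn (fun i => q_down a b i);
       Phi_X_ge a b;
       Phi_DGS_ge a b;
       Phi_RGS_ge a b p].
Proof.
set A := limn (fun i => a i / a i.-1); pose L := limn (fun i => a i / b i).
have cvg_aa : (fun i => a i.+2 / a i.+1) @ \oo --> A.
  rewrite (cvg_shiftS (fun i => a i.+1 / a i)).
  by rewrite (cvg_shiftS (fun i => a i / a i.-1)).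
have cvg_ab : (fun i => a i.+1 / b i.+1) @ \oo --> L.
  by rewrite (cvg_shiftS (fun i => a i / b i)).
have [A0 L0] := ratio_lim_ge0 a_gt0 b_gt0 cvg_aa cvg_ab.
have cvg1 : (fun i => (a i / b i.-1)%:E) @ \oo --> (A * L)%:E.
  apply: cvg_EFin; first exact: nearW.
  exact: (cvg_a_b1 a_gt0 cvg_aa cvg_ab).
(* In the extended reals this limit exists even if [L = 0], and its finiteness means [L != 0]. *)
have cvg2 : (fun i => (b i / a i)%:E) @ \oo --> (if L == 0%R then +oo else (L^-1)%:E)%E.
  case: eqP => [L00|/eqP LN0].
    apply/cvgeryP; exact: (cvg_b_a_pinfty a_gt0 b_gt0 cvg_ab L00).
  apply: cvg_EFin; first exact: nearW.
  apply: (cvg_b_a cvg_ab); by rewrite lt_neqAle eq_sym LN0.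
have cvg3 := cvg_up_down a_gt0 b_gt0 cvg_aa cvg_ab.
have cvg4 := cvg_down a_gt0 b_gt0 cvg_aa cvg_ab.
have ab_le1 := sum_ab_le1 a_gt0 b_gt0 sum1.
have ab_cvg := sum_ab_cvg a_gt0 b_gt0 sum1.
split; first by split; apply/cvg_ex; eexists; eassumption.
rewrite !(cvg_lim _ cvg1, cvg_lim _ cvg2, cvg_lim _ cvg3, cvg_lim _ cvg4)//.
have q0 : (0 < L / ((A * L + 1) * (L + 1))) = (0 < L).
  by rewrite pmulr_lgt0// invr_gt0 mulr_gt0// ltr_wpDl ?mulr_ge0.
have nec : geometric_tail_and_exit a b -> 0 < L /\ A < 1.
  move=> [M [t [e [N [t01 aM e0 eN]]]]].
  exact: (ratio_lim_of_geometric a_gt0 b_gt0 cvg_aa cvg_ab t01 aM e0 eN).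
have nec_X : Phi_X_ge a b -> 0 < L /\ A < 1.
  by move=> /(Phi_X_geometric a_gt0 b_gt0 b0 ab_le1)
    /(X_geometric_tail_and_exit a_gt0 b_gt0 b0)/nec.
have nec_D : Phi_DGS_ge a b -> 0 < L /\ A < 1.
  by move=> /(Phi_DGS_geometric a_gt0 b_gt0 b0 ab_le1)
    /(X_geometric_tail_and_exit a_gt0 b_gt0 b0)/nec.
have nec_R : Phi_RGS_ge a b p -> 0 < L /\ A < 1.
  by move=> /(Phi_RGS_geometric a_gt0 b_gt0 b0 ab_le1 p01)
    /(R_geometric_tail_and_exit a_gt0 b_gt0 p01)/nec.
have bounds := bounds_of_ratio_lim a_gt0 b_gt0 cvg_aa cvg_ab.
(* From (c) on, each link of the cycle passes through [0 < L] and [A < 1], recovered from one chain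
   and used to build the bounds for the next. *)
tfae.
- move=> [_ + A1]; case: eqVneq => // LN0 _; split=> //.
  by rewrite q0 lt_neqAle eq_sym LN0.
- rewrite q0 => -[A1 L1]; have [B [C [V [[aB aB'] C0 V0 Vd VC]]]] := bounds L1 A1.
  exact: (Phi_X_ge_of_bounds a_gt0 b_gt0 b0 ab_le1 aB aB' C0 V0 Vd VC ab_cvg).
- move=> /nec_X[L1 A1]; have [B [C [V [[aB aB'] C0 V0 Vd VC]]]] := bounds L1 A1.
  exact: (Phi_DGS_ge_of_bounds a_gt0 b_gt0 b0 ab_le1 aB aB' C0 V0 Vd VC ab_cvg).
- move=> /nec_D[L1 A1]; have [B [C [V [[aB aB'] C0 V0 Vd VC]]]] := bounds L1 A1.
  exact: (Phi_RGS_ge_of_bounds a_gt0 b_gt0 b0 ab_le1 aB aB' C0 V0 Vd VC ab_cvg p01).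
- move=> /nec_R[L1 A1]; split=> //; first exact: ltry.
  by rewrite gt_eqF// ltry.
Qed.
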